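(* Let $\mu$ be a partition of $n\ge1$, let $\lambda$ be a partition with $|\lambda|\le n-\mu_2$, and let $r\ge0$ be an integer. Then $g^{\lambda}_{\mu}=g^{\lambda}_{\mu+re_1}$, that is, $$\dim\mathrm{Hom}_{S_{n}}(V^{\mu},{}_{n}F^{\lambda})=\dim\mathrm{Hom}_{S_{n+r}}(V^{\mu+re_{1}},{}_{n+r}F^{\lambda}).$$
   Context: For a partition $\nu$ of $N$, $V^\nu$ is the irreducible complex representation of $S_N$ indexed by $\nu$ (so $V^{(N)}$ is trivial). For a partition $\lambda$ with at most $N$ nonzero parts, ${}_NF^\lambda$ is the irreducible polynomial representation of $GL(N,\mathbb{C})$ with highest weight $\lambda$ (padded by zeros), and it is regarded as an $S_N$-module by restriction to the subgroup $S_N\subset GL(N,\mathbb{C})$ of permutation matrices. $g_\nu^\lambda=\dim\mathrm{Hom}_{S_N}(V^\nu,{}_NF^\lambda)$ for $\nu\vdash N$. $\mu+re_1=(\mu_1+r,\mu_2,\dots)$ is the partition of $n+r$ obtained by adding $r$ to the first part of $\mu$. If $\mu$ has only one part, $\mu_2=0$. $|\lambda|=\sum\lambda_i$. *)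

(* Defs.v *)
(* Mathematical Components, with [reals] for the ground field: R is any model
   of the real numbers and C = R[i]. *)
From HB Require Import structures.
From mathcomp Require Import all_boot all_order all_fingroup all_algebra.
From mathcomp Require Import mxrepresentation.
From mathcomp Require Import reals complex.
From mathcomp Require mpoly.

Set Implicit Arguments.
Unset Strict Implicit.
Unset Printing Implicit Defensive.

Import GRing.Theory.
Local Open Scope ring_scope.

(** * Partitions *)

Definition is_part (nu : seq nat) : bool := sorted geq nu && (0%N \notin nu).

Definition is_part_of (N : nat) (nu : seq nat) : bool :=
  is_part nu && (sumn nu == N).

Definition add_first_part (r : nat) (mu : seq nat) : seq nat :=
  (head 0 mu + r)%N :: behead mu.

(** * Specht modules

   The cells of the diagram of nu are numbered 0, 1, 2, ... row after row from
   left to right.  Cell k lies in row [reshape_index nu k] and in column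
   [reshape_offset nu k]. *)

Definition row_stab (N : nat) (nu : seq nat) : {set 'S_N} :=
  [set s : 'S_N | [forall k : 'I_N,
     reshape_index nu (s k) == reshape_index nu k]].

Definition col_stab (N : nat) (nu : seq nat) : {set 'S_N} :=
  [set s : 'S_N | [forall k : 'I_N,
     reshape_offset nu (s k) == reshape_offset nu k]].

(* The Young symmetrizer, i.e. the sum of sgn(q) (p o q) for p in the row
   stabilizer and q in the column stabilizer, as a vector of the regular
   representation.  The product of permutations in the library satisfies
   (q * p) k = p (q k), so p o q is written q * p. *)
Definition young_symmetrizer (F : fieldType) (N : nat) (nu : seq nat) :
    'rV[F]_#|[set: 'S_N]| :=
  \sum_(p in row_stab N nu) \sum_(q in col_stab N nu)
    (-1) ^+ (odd_perm q) *: delta_mx 0 (gring_index [set: 'S_N]%G (q * p)%g).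

(* The library's representations act on row vectors on the right, and the
   regular representation sends the basis vector y to y * s = s o y.  With the
   usual composition of permutations this is the left regular module, and the
   cyclic submodule below is the left ideal generated by the symmetrizer. *)
Definition specht (F : fieldType) (N : nat) (nu : seq nat) :=
  submod_repr (cyclic_mx_module (regular_repr F [set: 'S_N]%G)
                                (young_symmetrizer F N nu)).

(** * Representations of the general linear group *)

(* Only the values at invertible matrices matter; GL(N) acts on column vectors
   on the left. *)
Record gl_rep (F : fieldType) (N m : nat) := GlRep {
  gl_fun :> 'M[F]_N -> 'M[F]_m;
  gl_fun1 : gl_fun 1%:M = 1%:M;
  gl_funM : forall g h : 'M[F]_N, g \in unitmx -> h \in unitmx ->
    gl_fun (g *m h) = gl_fun g *m gl_fun h }.

(* Every matrix coefficient is a polynomial in the N * N entries of g. *)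
Definition gl_polynomial (F : fieldType) (N m : nat) (rho : gl_rep F N m) :
    Prop :=
  forall i j : 'I_m, exists p : mpoly.mpoly (N * N) F,
    forall g : 'M[F]_N, g \in unitmx ->
      rho g i j = mpoly.meval (fun k => mxvec g 0 k) p.

Definition gl_irreducible (F : fieldType) (N m : nat) (rho : gl_rep F N m) :
    Prop :=
  (0 < m)%N /\
  forall U : {vspace 'cV[F]_m},
    (forall (g : 'M[F]_N) (v : 'cV[F]_m),
       g \in unitmx -> v \in U -> rho g *m v \in U) ->
    U = 0%VS \/ U = fullv.

Definition upper_unitriangular (F : fieldType) (N : nat) (u : 'M[F]_N) : Prop :=
  is_trig_mx u^T /\ forall i : 'I_N, u i i = 1.

(* The weight lam is padded by zeros. *)
Definition highest_weight_vector (F : fieldType) (N m : nat)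
    (rho : gl_rep F N m) (lam : seq nat) (v : 'cV[F]_m) : Prop :=
  [/\ v != 0,
      forall u : 'M[F]_N, upper_unitriangular u -> rho u *m v = v &
      forall t : 'rV[F]_N, (forall i : 'I_N, t 0 i != 0) ->
        rho (diag_mx t) *m v = (\prod_(i < N) t 0 i ^+ nth 0%N lam i) *: v].

Definition irr_poly_gl_rep (F : fieldType) (N m : nat) (lam : seq nat)
    (rho : gl_rep F N m) : Prop :=
  [/\ gl_polynomial rho, gl_irreducible rho &
      exists v : 'cV[F]_m, highest_weight_vector rho lam v].

(** * Restriction to permutation matrices *)

(* Since (perm_mx s) i j = (s i == j), the permutation matrix that sends the
   j-th basis column to the (s j)-th one is (perm_mx s)^T.  The outer
   transposition turns the left action on columns into the action on rows used
   by [mx_representation]. *)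
Definition perm_restr_fun (F : fieldType) (N m : nat) (rho : gl_rep F N m)
    (s : 'S_N) : 'M[F]_m := (rho (perm_mx s)^T)^T.

Lemma perm_restr_mx_repr (F : fieldType) (N m : nat) (rho : gl_rep F N m) :
  mx_repr [set: 'S_N] (perm_restr_fun rho).
Proof.
split=> [|s t _ _]; rewrite /perm_restr_fun.
  by rewrite perm_mx1 trmx1 gl_fun1 trmx1.
by rewrite perm_mxM trmx_mul gl_funM ?unitmx_tr ?unitmx_perm // trmx_mul.
Qed.

Definition perm_restr (F : fieldType) (N m : nat) (rho : gl_rep F N m) :
    mx_representation F [set: 'S_N] m :=
  MxRepresentation (perm_restr_mx_repr rho).

(** * Equivariant maps *)

(* Matrices A such that u |-> u *m A commutes with the actions of G. *)
Definition Hom_repr (F : fieldType) (gT : finGroupType) (G : {group gT})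
    (m1 m2 : nat) (rV : mx_representation F G m1)
    (rW : mx_representation F G m2) : {vspace 'M[F]_(m1, m2)} :=
  (\bigcap_(x in G)
     lker (linfun (fun A : 'M[F]_(m1, m2) => (rV x *m A - A *m rW x)%R)))%VS.
(* [linfun] is only meaningful on linear functions, whence the lemma below. *)
Lemma mem_Hom_repr (F : fieldType) (gT : finGroupType) (G : {group gT})
    (m1 m2 : nat) (rV : mx_representation F G m1)
    (rW : mx_representation F G m2) (A : 'M[F]_(m1, m2)) :
  reflect (forall x, x \in G -> rV x *m A = A *m rW x) (A \in Hom_repr rV rW).
Proof.
pose f x (B : 'M[F]_(m1, m2)) := rV x *m B - B *m rW x.
have flin x : linear (f x).
  move=> a B D; rewrite /f mulmxDr mulmxDl -scalemxAr -scalemxAl scalerBr.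
  by rewrite opprD addrACA.
have fE x : linfun (f x) A = f x A.
  pose L := GRing.isLinear.Build _ _ _ _ (f x) (flin x).
  pose g : {linear _ -> _} := HB.pack (f x) L.
  exact: (lfunE g A).
have memE : (A \in Hom_repr rV rW) = [forall (x | x \in G), A \in lker (linfun (f x))].
  rewrite memvE; apply/subv_bigcapP/forall_inP => H x Gx.
    by rewrite memvE; apply: H.
  by rewrite -memvE; apply: H.
rewrite memE; apply: (iffP forall_inP) => H x Gx.
  by have := H x Gx; rewrite memv_ker fE subr_eq0 => /eqP.
by rewrite memv_ker fE /f H // subrr.
Qed.

(* Main.v *)
(* The restriction multiplicity is the rank of the Young symmetrizer e_mu on
   F^lambda, because Hom(A e, W) ~ e W by complete reducibility.

   Going from N to N + 1 variables, the vectors of F^lambda_{N+1} whose support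
   (the set of coordinates involved in the weight) avoids the new cell z form
   F^lambda_N.  Supports have at most |lambda| elements.  If the support of a
   vector misses two cells of one column, the column antisymmetrizer kills it;
   otherwise |lambda| <= N - mu_2 and a count of the missed cells provide a
   missed one-cell column, and the transposition exchanging it with z moves the
   support off z.  So the image of e_{mu + e_1} comes from F^lambda_N.
   Conversely the row symmetrizer of the larger diagram loses no information on
   F^lambda_N, since each support component of the symmetrized vector is a
   positive multiple of the original one.

   It remains that F^lambda_N is determined by its highest weight: the
   highest weight coefficient of g v is determined on the dense big cell. *)
Require Import Defs.
From mathcomp Require Import all_boot all_order all_fingroup all_algebra.
From mathcomp Require Import mxrepresentation.
From mathcomp Require Import reals complex.
From mathcomp Require Import -(notations) mpoly.
From mathcomp Require Import boolp.

Set Implicit Arguments.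
Unset Strict Implicit.
Unset Printing Implicit Defensive.

Import Order.TTheory GRing.Theory Num.Theory.
Local Open Scope ring_scope.

(** * Polynomial curves of matrices *)

Lemma poly_eq0_horner (F : numFieldType) (p : {poly F}) : (forall x, p.[x] = 0) -> p = 0.
Proof.
move=> p0; apply/eqP; apply: contraT => nz_p.
pose s := [seq i%:R | i <- iota 0 (size p)] : seq F.
have := @max_poly_roots _ p s nz_p.
rewrite size_map size_iota ltnn => -> //.
  by apply/allP => x _; rewrite rootE p0.
by rewrite map_inj_uniq ?iota_uniq // => i j /eqP; rewrite eqr_nat => /eqP.
Qed.

(** Density in one variable: [(p - q) * d] vanishes at every point of an infinite field, hence is
    zero. It carries identities from generic [x] to special values, mostly [x = 0]. *)
Lemma poly_eq_generic (F : numFieldType) (d p q : {poly F}) :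
  d != 0 -> (forall x, d.[x] != 0 -> p.[x] = q.[x]) -> p = q.
Proof.
move=> nz_d pq; apply/eqP; rewrite -subr_eq0.
suff: (p - q) * d == 0 by rewrite mulf_eq0 (negPf nz_d) orbF.
apply/eqP/poly_eq0_horner => x; rewrite hornerM !hornerE.
by case: (eqVneq d.[x] 0) => [->|/pq ->]; rewrite ?mulr0 // subrr mul0r.
Qed.

Definition eval_mx (F : fieldType) m n (x : F) (B : 'M[{poly F}]_(m, n)) : 'M[F]_(m, n) :=
  map_mx (horner_eval x) B.

Lemma eval_mxM (F : fieldType) m n k (x : F) (B : 'M_(m, n)) (D : 'M_(n, k)) :
  eval_mx x (B *m D) = eval_mx x B *m eval_mx x D.
Proof. exact: map_mxM. Qed.

Lemma eval_mxC (F : fieldType) m n (x : F) (A : 'M_(m, n)) :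
  eval_mx x (map_mx polyC A) = A.
Proof. by apply/matrixP => i j; rewrite !mxE /horner_eval hornerC. Qed.

Lemma eval_mx_eq_generic (F : numFieldType) m n (d : {poly F}) (B D : 'M_(m, n)) :
  d != 0 -> (forall x, d.[x] != 0 -> eval_mx x B = eval_mx x D) -> B = D.
Proof.
move=> nz_d BD; apply/matrixP => i j; apply: (poly_eq_generic nz_d) => x /BD.
by move/matrixP/(_ i j); rewrite !mxE.
Qed.

(** The line through [A] at parameter 0. Its determinant is the characteristic polynomial of [- A],
    which is monic, so all but finitely many of its points are invertible. *)
Definition shift_mx (F : fieldType) n (A : 'M[F]_n) : 'M[{poly F}]_n :=
  'X%:M + map_mx polyC A.

Lemma eval_shift_mx (F : fieldType) n (A : 'M[F]_n) x :
  eval_mx x (shift_mx A) = x%:M + A.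
Proof.
by apply/matrixP => i j; rewrite !mxE /horner_eval hornerD hornerC hornerMn hornerX.
Qed.

Lemma shift_mx_char (F : fieldType) n (A : 'M[F]_n) : shift_mx A = char_poly_mx (- A).
Proof. by apply/matrixP => i j; rewrite !mxE rmorphN opprK. Qed.

Lemma shift_mx_unit (F : fieldType) n (A : 'M[F]_n) x :
  (char_poly (- A)).[x] != 0 -> x%:M + A \in unitmx.
Proof.
rewrite unitmxE unitfE -eval_shift_mx /eval_mx det_map_mx shift_mx_char.
by [].
Qed.

Lemma char_poly_neq0 (F : fieldType) n (A : 'M[F]_n) : char_poly A != 0.
Proof. exact/monic_neq0/char_poly_monic. Qed.

Lemma meval_curve (F : fieldType) K (p : mpoly K F) (l : 'I_K -> {poly F}) :
  exists q : {poly F}, forall x, q.[x] = meval (fun k => (l k).[x]) p.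
Proof.
exists (\sum_(m <- msupp p) mcoeff m p *: \prod_k (l k) ^+ fun_of_multinom m k).
move=> x; rewrite mevalE horner_sum; apply: eq_bigr => m _.
rewrite hornerZ horner_prod; congr (_ * _); apply: eq_bigr => k _.
by rewrite horner_exp.
Qed.

(** Polynomiality in the form used below: along a polynomial curve of matrices, the values of [f]
    are those of one polynomial matrix. The predicate [P] allows for maps that are meaningful only
    at invertible matrices. *)
Definition curve_poly (F : fieldType) N m (f : 'M[F]_N -> 'M[F]_m) (P : {pred 'M[F]_N}) :=
  forall c : 'M[{poly F}]_N, exists B : 'M[{poly F}]_m,
    forall x, eval_mx x c \in P -> eval_mx x B = f (eval_mx x c).

Lemma curve_polyW (F : fieldType) N m (f : 'M[F]_N -> 'M[F]_m) (P : {pred 'M[F]_N}) :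
  (forall i j, exists p : mpoly (N * N) F, forall g, g \in P ->
     f g i j = meval (fun k => mxvec g 0 k) p) ->
  curve_poly f P.
Proof.
move=> fP c.
have fq ij : exists q : {poly F}, forall x, eval_mx x c \in P -> q.[x] = f (eval_mx x c) ij.1 ij.2.
  have [p pE] := fP ij.1 ij.2.
  have [q qE] := meval_curve p (fun k => mxvec c 0 k).
  exists q => x Pc; rewrite qE (pE _ Pc); congr (meval _ p).
  by apply/funext => k; rewrite /eval_mx -map_mxvec mxE.
have [h hE] := choice fq.
exists (\matrix_(i, j) h (i, j)) => x Pc; apply/matrixP => i j.
by rewrite !mxE /horner_eval hE.
Qed.

Lemma gl_polynomial_curve (F : fieldType) N m (rho : gl_rep F N m) :
  gl_polynomial rho -> curve_poly rho unitmx.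
Proof. by move=> pol; apply: curve_polyW. Qed.

(** The polynomials defining [rho] make sense at singular matrices too, in particular at coordinate
    projections. Multiplicativity extends by density, comparing both sides along the lines through
    [g] and [g']. *)
Lemma gl_polynomial_ext (F : numFieldType) N m (rho : gl_rep F N m) :
  gl_polynomial rho -> exists sg : 'M[F]_N -> 'M[F]_m,
  [/\ forall g, g \in unitmx -> sg g = rho g,
      forall g h, sg (g *m h) = sg g *m sg h &
      forall i j, exists p : mpoly (N * N) F,
        forall g, sg g i j = meval (fun k => mxvec g 0 k) p].
Proof.
move=> pol.
have [h hE] := choice (fun ij : 'I_m * 'I_m => pol ij.1 ij.2).
pose sg g : 'M[F]_m := \matrix_(i, j) meval (fun k => mxvec g 0 k) (h (i, j)).
have sgE g : g \in unitmx -> sg g = rho g.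
  by move=> Ug; apply/matrixP => i j; rewrite mxE (hE (i, j)).
have sgP : curve_poly sg predT.
  by apply: curve_polyW => i j; exists (h (i, j)) => g _; rewrite mxE.
exists sg; split => // [g g'|i j]; last by exists (h (i, j)) => g; rewrite mxE.
have [B BE] := sgP (shift_mx g *m shift_mx g').
have [B1 B1E] := sgP (shift_mx g).
have [B2 B2E] := sgP (shift_mx g').
have atE a : eval_mx 0 (shift_mx a) = a :> 'M[F]_N.
  by rewrite eval_shift_mx raddf0 add0r.
suff BB : B = B1 *m B2.
  by have := BE 0 isT; rewrite BB eval_mxM B1E // B2E // eval_mxM !atE.
apply: (@eval_mx_eq_generic _ _ _ (char_poly (- g) * char_poly (- g'))).
  by rewrite mulf_neq0 ?char_poly_neq0.
move=> x; rewrite hornerM mulf_eq0 negb_or => /andP[/shift_mx_unit Ug /shift_mx_unit Ug'].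
rewrite eval_mxM BE // B1E // B2E // eval_mxM !eval_shift_mx !sgE ?unitmx_mul ?Ug ?gl_funM //.
Qed.

(** * Irreducible representations and the big cell *)

(** Irreducibility speaks of [vspace]s, while the subspaces met below are given by propositions. The
    span of a longest free family inside [P] does the translation. *)
Lemma pred_vspace (F : fieldType) m (P : 'cV[F]_m -> Prop) :
  P 0 -> (forall a x y, P x -> P y -> P (a *: x + y)) ->
  exists U : {vspace 'cV[F]_m}, forall x, x \in U <-> P x.
Proof.
move=> P0 Plin.
pose Q k := `[< exists s : seq 'cV[F]_m, [/\ size s = k, free s & forall x, x \in s -> P x] >].
have exQ : exists k, Q k.
  by exists 0%N; apply/asboolP; exists [::]; split => //; apply: nil_free.
have ubQ k : Q k -> (k <= \dim {: 'cV[F]_m})%N.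
  case/asboolP=> s [<- /eqP <- _]; exact/dimvS/subvf.
case: (ex_maxnP exQ ubQ) => k /asboolP[s [sk fs Ps]] kmax.
exists <<s>>%VS => x; split.
  move=> /(@coord_span _ _ _ (in_tuple s)) ->; elim/big_ind: _ => //.
    by move=> y z Py Pz; rewrite -[y]scale1r; apply: Plin.
  move=> i _; rewrite -[_ *: _]addr0; apply: Plin => //.
  by apply: Ps; rewrite mem_nth.
move=> Px; apply: contraT => sx.
have : Q k.+1.
  apply/asboolP; exists (x :: s); split; rewrite /= ?sk //.
    by rewrite free_cons sx fs.
  by move=> y; rewrite inE => /orP[/eqP-> //|/Ps].
by move/kmax; rewrite ltnn.
Qed.

Lemma gl_irr_pred (F : fieldType) N m (rho : gl_rep F N m) (P : 'cV[F]_m -> Prop) :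
  gl_irreducible rho -> P 0 -> (forall a x y, P x -> P y -> P (a *: x + y)) ->
  (forall g x, g \in unitmx -> P x -> P (rho g *m x)) ->
  (forall x, P x -> x = 0) \/ (forall x, P x).
Proof.
move=> [_ irr] P0 Plin Pinv; have [U UP] := pred_vspace P0 Plin.
have [|UE|UE] := irr U.
- by move=> g v Ug /UP Pv; apply/UP/Pinv.
- by left=> x /UP; rewrite UE memv0 => /eqP.
by right=> x; apply/UP; rewrite UE memvf.
Qed.

(* The relation [Rel] below is a GL(N)-stable subspace of the product; irreducibility
   of both factors makes it the graph of an isomorphism. *)
Lemma gl_iso_of_coefficient (F : fieldType) N m k (rho : gl_rep F N m) (sg : gl_rep F N k)
    (xi : 'rV[F]_m) (eta : 'rV[F]_k) (v : 'cV[F]_m) (w : 'cV[F]_k) :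
  gl_irreducible rho -> gl_irreducible sg -> xi *m v != 0 ->
  (forall g, g \in unitmx -> xi *m (rho g *m v) = eta *m (sg g *m w)) ->
  exists (A : 'M[F]_(k, m)) (B : 'M[F]_(m, k)),
    [/\ A *m B = 1%:M, B *m A = 1%:M &
        forall g, g \in unitmx -> A *m rho g = sg g *m A].
Proof.
move=> irr irs xiv coef.
pose Rel (x : 'cV[F]_m) (y : 'cV[F]_k) :=
  forall g, g \in unitmx -> xi *m (rho g *m x) = eta *m (sg g *m y).
have Rlin a x y x' y' : Rel x y -> Rel x' y' -> Rel (a *: x + x') (a *: y + y').
  move=> Rxy Rxy' g Ug.
  by rewrite !mulmxDr -!scalemxAr (Rxy _ Ug) (Rxy' _ Ug).
have R0 : Rel 0 0 by move=> g _; rewrite !mulmx0.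
have Rinv g x y : g \in unitmx -> Rel x y -> Rel (rho g *m x) (sg g *m y).
  move=> Ug Rxy h Uh; rewrite (mulmxA (rho h)) (mulmxA (sg h)) -!gl_funM //.
  by rewrite Rxy // unitmx_mul Uh Ug.
have R1 x y : Rel x y -> xi *m x = eta *m y.
  by move/(_ 1%:M (unitmx1 _ _)); rewrite !gl_fun1 !mul1mx.
have Rx0 x : Rel x 0 -> x = 0.
  have [//|||all|all] := gl_irr_pred (P := fun x => Rel x 0) irr.
  - by move=> a x' y' Rx Ry; have := Rlin a _ _ _ _ Rx Ry; rewrite scaler0 addr0.
  - by move=> g x' Ug Rx; have := Rinv g _ _ Ug Rx; rewrite mulmx0.
  - exact: all.
  by have := R1 _ _ (all v); rewrite mulmx0 => xv0; rewrite xv0 eqxx in xiv.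
have R0y y : Rel 0 y -> y = 0.
  have [//|||all|all] := gl_irr_pred (P := fun y => Rel 0 y) irs.
  - by move=> a x' y' Rx Ry; have := Rlin a _ _ _ _ Rx Ry; rewrite scaler0 addr0.
  - by move=> g x' Ug Rx; have := Rinv g _ _ Ug Rx; rewrite mulmx0.
  - exact: all.
  by have := R1 _ _ (all w); rewrite mulmx0 -(R1 _ _ coef) => xv0; rewrite -xv0 eqxx in xiv.
have vn0 : v != 0 by apply: contraNneq xiv => ->; rewrite mulmx0.
have wn0 : w != 0 by apply: contraNneq xiv => w0; rewrite (R1 _ _ coef) w0 mulmx0.
have totl x : exists y, Rel x y.
  have [|||all|all] := gl_irr_pred (P := fun x => exists y, Rel x y) irr.
  - by exists 0.
  - by move=> a x1 x2 [y1 Ry1] [y2 Ry2]; exists (a *: y1 + y2); apply: Rlin.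
  - by move=> g x1 Ug [y1 Ry1]; exists (sg g *m y1); apply: Rinv.
  - by case/eqP: vn0; apply: all; exists w.
  exact: all.
have totr y : exists x, Rel x y.
  have [|||all|all] := gl_irr_pred (P := fun y => exists x, Rel x y) irs.
  - by exists 0.
  - by move=> a x1 x2 [y1 Ry1] [y2 Ry2]; exists (a *: y1 + y2); apply: Rlin.
  - by move=> g x1 Ug [y1 Ry1]; exists (rho g *m y1); apply: Rinv.
  - by case/eqP: wn0; apply: all; exists v.
  exact: all.
have uniql x y y' : Rel x y -> Rel x y' -> y = y'.
  move=> Ry Ry'; apply/eqP; rewrite -subr_eq0; apply/eqP/R0y.
  by have := Rlin (-1) _ _ _ _ Ry' Ry; rewrite !scaleN1r addNr addrC.
have uniqr x x' y : Rel x y -> Rel x' y -> x = x'.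
  move=> Ry Ry'; apply/eqP; rewrite -subr_eq0; apply/eqP/Rx0.
  by have := Rlin (-1) _ _ _ _ Ry' Ry; rewrite !scaleN1r addNr addrC.
have Rsum n (x : 'I_n -> 'cV_m) (y : 'I_n -> 'cV_k) (c : 'cV_n) :
    (forall i, Rel (x i) (y i)) ->
    Rel (\sum_i c i 0 *: x i) (\sum_i c i 0 *: y i).
  move=> Rxy; elim/big_rec2: _ => // i y1 x1 _ R'.
  exact: Rlin.
have colsum p q (M : 'M[F]_(p, q)) c : M *m c = \sum_i c i 0 *: col i M.
  apply/matrixP=> i j; rewrite !mxE summxE (ord1 j); apply: eq_bigr => l _.
  by rewrite !mxE mulrC.
(* The columns of [A] and [B] are partners of the basis vectors; linearity of [Rel] extends this to
   all vectors. *)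
have [fA fAE] := choice (fun i : 'I_m => totl (delta_mx i 0)).
have [fB fBE] := choice (fun i : 'I_k => totr (delta_mx i 0)).
pose A : 'M[F]_(k, m) := \matrix_(i, j) fA j i 0.
pose B : 'M[F]_(m, k) := \matrix_(i, j) fB j i 0.
have RA x : Rel x (A *m x).
  rewrite -[x in Rel x _]mul1mx !colsum; apply: Rsum => i.
  have -> : col i A = fA i by apply/matrixP=> a b; rewrite !mxE (ord1 b).
  suff -> : col i 1%:M = delta_mx i 0 :> 'cV[F]_m by [].
  by apply/matrixP => a b; rewrite !mxE (ord1 b) andbT.
have RB y : Rel (B *m y) y.
  rewrite -[y in Rel _ y]mul1mx !colsum; apply: Rsum => i.
  have -> : col i B = fB i by apply/matrixP=> a b; rewrite !mxE (ord1 b).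
  suff -> : col i 1%:M = delta_mx i 0 :> 'cV[F]_k by [].
  by apply/matrixP => a b; rewrite !mxE (ord1 b) andbT.
have eqcol p q (M M' : 'M[F]_(p, q)) : (forall x : 'cV_q, M *m x = M' *m x) -> M = M'.
  move=> MM; apply/matrixP => i j; have := MM (delta_mx j 0).
  by rewrite -!colE => /matrixP/(_ i 0); rewrite !mxE.
exists A, B; split=> [||g Ug]; apply: eqcol => x.
- by rewrite mul1mx -mulmxA; apply: (uniql (B *m x)).
- by rewrite mul1mx -mulmxA; apply: (uniqr _ _ (A *m x)).
by rewrite -!mulmxA; apply: (uniql (rho g *m x)) => //; apply: Rinv.
Qed.

(** * Triangular factorization of generic matrices *)

Definition lower_unitriangular (F : fieldType) N (l : 'M[F]_N) : Prop :=
  is_trig_mx l /\ forall i, l i i = 1.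

Lemma lower_unitriangular_unit (F : fieldType) N (l : 'M[F]_N) :
  lower_unitriangular l -> l \in unitmx.
Proof.
case=> tl dl; rewrite unitmxE unitfE det_trig // big1 ?oner_eq0 //.
Qed.

Lemma upper_unitriangular_unit (F : fieldType) N (u : 'M[F]_N) :
  upper_unitriangular u -> u \in unitmx.
Proof.
case=> tu du; rewrite -unitmx_tr; apply: lower_unitriangular_unit.
by split=> // i; rewrite mxE.
Qed.

Lemma diag_mx_unit (F : fieldType) N (t : 'rV[F]_N) :
  (forall i, t 0 i != 0) -> diag_mx t \in unitmx.
Proof. by move=> nzt; rewrite unitmxE unitfE det_diag; apply/prodf_neq0. Qed.

(** Induction on the size, by block elimination with the lower right block [D] as pivot. The factor
    [d] makes [D] factorizable, and the characteristic polynomial makes the whole matrix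
    invertible. *)
Lemma UDL_generic (F : fieldType) n (A : 'M[F]_n) :
  exists2 d : {poly F}, d != 0 & forall x, d.[x] != 0 ->
  exists (u l : 'M[F]_n) (t : 'rV[F]_n),
    [/\ upper_unitriangular u, lower_unitriangular l, forall i, t 0 i != 0 &
        x%:M + A = u *m diag_mx t *m l].
Proof.
elim: n => [|n IHn] in A *.
  exists 1; first exact: oner_neq0.
  move=> x _; exists 1%:M, 1%:M, 0; split.
  - by split; [apply/is_trig_mxP; case | case].
  - by split; [apply/is_trig_mxP; case | case].
  - by case.
  - by rewrite [LHS]flatmx0 [RHS]flatmx0.
pose A' : 'M_(1 + n) := A.
have [d nz_d dP] := IHn (drsubmx A').
exists (d * char_poly (- A)); first by rewrite mulf_neq0 ?char_poly_neq0.
move=> x; rewrite hornerM mulf_eq0 negb_or => /andP[/dP[u [l [t [Uu Ll nzt DE]]]] UA].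
have {}UA := shift_mx_unit UA.
pose D := x%:M + drsubmx A'.
have UD : D \in unitmx.
  rewrite /D DE !unitmx_mul (upper_unitriangular_unit Uu) (lower_unitriangular_unit Ll).
  by rewrite diag_mx_unit.
pose b := ursubmx A'; pose c := dlsubmx A'.
(* The Schur complement of [D], which becomes the new diagonal entry. *)
pose s := x%:M + ulsubmx A' - b *m invmx D *m c.
pose u' : 'M_(1 + n) := block_mx 1%:M (b *m invmx D *m u) 0 u.
pose l' : 'M_(1 + n) := block_mx 1%:M 0 (l *m invmx D *m c) l.
pose t' : 'rV_(1 + n) := row_mx s t.
have AE : x%:M + A' = u' *m diag_mx t' *m l'.
  rewrite /u' /l' /t' diag_mx_row !mulmx_block !mul1mx !mul0mx !mulmx0 !addr0 !add0r !mulmx1.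
  have sE : diag_mx s = s by apply/matrixP=> i j; rewrite !ord1 !mxE eqxx mulr1n.
  rewrite sE -[in LHS](submxK A') scalar_mx_block add_block_mx !add0r -/D -/b -/c.

  have E1 k (M : 'M_(n, k)) : u *m diag_mx t *m (l *m M) = D *m M by rewrite mulmxA -DE.
  have E2 k (M : 'M_(k, n)) : M *m u *m diag_mx t *m l = M *m D by rewrite -!mulmxA (mulmxA u) -DE.
  rewrite -(mulmxA l) E1 !E2 mulmxA E2 -DE (mulmxKV UD) (mulKVmx UD).
  by rewrite /s mulmxA subrK.
have trigP B C : is_trig_mx C -> is_trig_mx (block_mx 1%:M 0 B C : 'M[F]_(1 + n)).
  by move=> tC; rewrite is_trig_block_mx // eqxx tC scalar_mx_is_trig.
have diagP B C (E : 'M[F]_n) : (forall i, E i i = 1) ->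
    forall i, (block_mx 1%:M B C E : 'M[F]_(1 + n)) i i = 1.
  move=> E1i i; rewrite -(splitK i); case: (split i) => j /=.
    by rewrite block_mxEul mxE eqxx.
  by rewrite block_mxEdr.
case: Uu Ll => tu du [tl dl]; exists u', l', t'; split=> //.
- by split; [rewrite [u'^T]tr_block_mx trmx0 trmx1; apply: trigP | apply: diagP].
- by split; [apply: trigP | apply: diagP].
(* The new entry [s] is nonzero because the whole product is invertible. *)
move=> i; have : diag_mx t' \in unitmx.
  by move: UA; rewrite AE !unitmx_mul => /andP[/andP[]].
by rewrite unitmxE unitfE det_diag => /prodf_neq0; apply.
Qed.

(** Conjugation by the order-reversing permutation, which exchanges upper and lower triangular
    matrices. *)
Definition rev_mx (F : fieldType) n (A : 'M[F]_n) : 'M[F]_n :=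
  \matrix_(i, j) A (rev_ord i) (rev_ord j).

Lemma rev_mxM (F : fieldType) n (A B : 'M[F]_n) : rev_mx (A *m B) = rev_mx A *m rev_mx B.
Proof.
apply/matrixP=> i j; rewrite !mxE (reindex_inj rev_ord_inj).
by apply: eq_bigr => k _; rewrite !mxE.
Qed.

Lemma rev_mxK (F : fieldType) n : involutive (@rev_mx F n).
Proof. by move=> A; apply/matrixP=> i j; rewrite !mxE !rev_ordK. Qed.

Lemma LDU_generic (F : fieldType) n (A : 'M[F]_n) :
  exists2 d : {poly F}, d != 0 & forall x, d.[x] != 0 ->
  exists (l u : 'M[F]_n) (t : 'rV[F]_n),
    [/\ lower_unitriangular l, upper_unitriangular u, forall i, t 0 i != 0 &
        x%:M + A = l *m diag_mx t *m u].
Proof.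
have [d nz_d dP] := UDL_generic (rev_mx A).
exists d => // x /dP[u [l [t [[tu du] [tl dl] nzt E]]]].
have revlt (i j : 'I_n) : (i < j)%N -> (rev_ord j < rev_ord i)%N.
  by move=> ij; rewrite /= ltn_sub2l ?ltnS // (leq_ltn_trans ij) // ltnS ltnW.
exists (rev_mx u), (rev_mx l), (\row_i t 0 (rev_ord i)); split.
- split=> [|i]; last by rewrite mxE.
  apply/is_trig_mxP => i j /revlt ij; rewrite mxE.
  by move/is_trig_mxP: tu => /(_ _ _ ij); rewrite mxE.
- split=> [|i]; last by rewrite mxE.
  apply/is_trig_mxP => i j /revlt ij; rewrite !mxE.
  by move/is_trig_mxP: tl => /(_ _ _ ij).
- by move=> i; rewrite mxE.
rewrite (_ : diag_mx _ = rev_mx (diag_mx t)); last first.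
  by apply/matrixP=> i j; rewrite !mxE (inj_eq rev_ord_inj); case: eqP => [->|].
rewrite -!rev_mxM -E -[LHS]rev_mxK; congr rev_mx.
by apply/matrixP=> i j; rewrite !mxE (inj_eq rev_ord_inj).
Qed.

(** * Uniqueness of the representation with a given highest weight *)

Lemma dual_vec (F : fieldType) m (v : 'cV[F]_m) : v != 0 ->
  exists z : 'rV[F]_m, z *m v = 1%:M.
Proof.
move=> nz_v; have [i vi] : exists i, v i 0 != 0.
  by apply/existsP; apply: contraR nz_v => /existsPn v0; apply/eqP/matrixP => i j;
    rewrite (ord1 j) mxE; apply/eqP; rewrite -[_ == _]negbK v0.
exists ((v i 0)^-1 *: delta_mx 0 i); rewrite -scalemxAl -rowE.
by apply/matrixP => a b; rewrite !ord1 !mxE mulVf.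
Qed.

Lemma coefp_mulmxC (F : fieldType) h m n k (B : 'M[{poly F}]_(m, n)) (D : 'M[F]_(n, k)) :
  map_mx (coefp h) (B *m map_mx polyC D) = map_mx (coefp h) B *m D.
Proof.
apply/matrixP => i j; rewrite !mxE /= coef_sum; apply: eq_bigr => l _.
by rewrite !mxE coefMC.
Qed.

Lemma coefp_Cmulmx (F : fieldType) h m n k (D : 'M[F]_(m, n)) (B : 'M[{poly F}]_(n, k)) :
  map_mx (coefp h) (map_mx polyC D *m B) = D *m map_mx (coefp h) B.
Proof.
apply/matrixP => i j; rewrite !mxE /= coef_sum; apply: eq_bigr => l _.
by rewrite !mxE coefCM.
Qed.

(* Conjugating l by the one-parameter subgroup diag(1, x, x^2, ...) contracts it
   to the identity as x -> 0; xi extracts the coefficient of x^h. *)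
Lemma hw_functional (F : numFieldType) N m lam (rho : gl_rep F N m) (v : 'cV[F]_m)
    (z : 'rV[F]_m) :
  curve_poly rho unitmx -> highest_weight_vector rho lam v ->
  exists xi : 'rV[F]_m, forall l : 'M[F]_N, lower_unitriangular l ->
    xi *m (rho l *m v) = z *m v.
Proof.
move=> pol [nz_v upv wtv].
pose tau x : 'rV[F]_N := \row_i x ^+ i.
pose tauX : 'M[{poly F}]_N := diag_mx (\row_i 'X^i).
have tauXE x : eval_mx x tauX = diag_mx (tau x).
  apply/matrixP=> i j; rewrite !mxE /horner_eval hornerMn hornerXn.
  by case: eqP => [->|]; rewrite ?mulr0n.
have tau_unit x : x != 0 -> diag_mx (tau x) \in unitmx.
  by move=> nz_x; apply: diag_mx_unit => i; rewrite mxE expf_neq0.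
have [B BE] := pol tauX.
pose h := (\sum_(i < N) i * nth 0 lam i)%N.
have tauv x : x != 0 -> rho (diag_mx (tau x)) *m v = x ^+ h *: v.
  move=> nz_x; rewrite wtv => [|i]; last by rewrite mxE expf_neq0.
  congr (_ *: _); rewrite -prodrXr; apply: eq_bigr => i _.
  by rewrite mxE exprM.
exists (z *m map_mx (coefp h) B) => l [tl dl].
(* The conjugate of [l] by the one-parameter subgroup. Truncated subtraction is harmless in the
   exponent, since [l i j = 0] for [i < j]. *)
pose c' : 'M[{poly F}]_N := \matrix_(i, j) ((l i j)%:P * 'X^(i - j)).
have c'E x : eval_mx x c' = \matrix_(i, j) (l i j * x ^+ (i - j)).
  by apply/matrixP=> i j; rewrite !mxE /horner_eval hornerCM hornerXn.
have c'L x : lower_unitriangular (eval_mx x c').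
  rewrite c'E; split=> [|i]; last by rewrite mxE dl subnn mulr1.
  by apply/is_trig_mxP=> i j ij; rewrite mxE (is_trig_mxP tl) ?mul0r.
have Uc x := lower_unitriangular_unit (c'L x).
have [B' B'E] := pol c'.
have tau_l x : diag_mx (tau x) *m l = eval_mx x c' *m diag_mx (tau x).
  apply/matrixP=> i j; rewrite mul_diag_mx mul_mx_diag c'E !mxE.
  have [ij|ji] := ltnP i j; first by rewrite (is_trig_mxP tl) // mulr0 !mul0r.
  by rewrite -mulrA -exprD subnK // mulrC.
pose D := map_mx polyC z *m B' *m map_mx polyC v.
have DE x : eval_mx x D = z *m (rho (eval_mx x c') *m v).
  by rewrite !eval_mxM !eval_mxC (B'E x (Uc x)) mulmxA.
(* Moving [tau x] past [l] turns it into the scalar [x ^+ h] on [v]. The coefficient of degree [h]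
   on the right is then the value of [D] at 0, where the contracted matrix is the identity. *)
have E : map_mx polyC z *m (B *m map_mx polyC (rho l *m v)) = 'X^h *: D.
  apply: (@eval_mx_eq_generic _ _ _ 'X); first by rewrite polyX_eq0.
  move=> x; rewrite hornerX => nz_x; rewrite !eval_mxM !eval_mxC BE tauXE ?tau_unit //.
  have Ul : l \in unitmx by apply: lower_unitriangular_unit.
  have Ut := tau_unit x nz_x.
  rewrite (mulmxA (rho _) (rho l)) -gl_funM ?Ut ?Ul // tau_l gl_funM ?Uc ?Ut //.
  rewrite -(mulmxA (rho _)) tauv // -!scalemxAr -DE.
  by apply/matrixP => i j; rewrite !mxE /horner_eval hornerM hornerXn.
rewrite -mulmxA -coefp_mulmxC -coefp_Cmulmx E.
have -> : map_mx (coefp h) ('X^h *: D) = eval_mx 0 D.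
  by apply/matrixP=> i j; rewrite !mxE /= /horner_eval coefXnM ltnn subnn horner_coef0.
rewrite DE (_ : eval_mx 0 c' = 1%:M) ?gl_fun1 ?mul1mx //.
rewrite c'E; apply/matrixP => i j; rewrite !mxE -val_eqE /= expr0n subn_eq0.
case: ltngtP => [ij|ji|ij].
- by rewrite (is_trig_mxP tl) ?mul0r.
- by rewrite mulr0.
by rewrite (val_inj ij) dl mulr1.
Qed.

(** At [l *m diag_mx t *m u] both matrix coefficients equal the weight of [t], whatever the
    representation: [u] fixes the highest weight vector, [t] scales it, and the functional does not
    see [l]. Such products are dense, so the coefficients agree on all of GL(N). *)
Lemma hw_rep_unique (F : numFieldType) N m k lam (rho : gl_rep F N m) (sg : gl_rep F N k) :
  irr_poly_gl_rep lam rho -> irr_poly_gl_rep lam sg ->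
  exists (A : 'M[F]_(k, m)) (B : 'M[F]_(m, k)),
    [/\ A *m B = 1%:M, B *m A = 1%:M &
        forall g, g \in unitmx -> A *m rho g = sg g *m A].
Proof.
move=> [/gl_polynomial_curve pr irr [v hv]] [/gl_polynomial_curve ps irs [w hw]].
have [z zv] : exists z : 'rV[F]_m, z *m v = 1%:M by apply: dual_vec; case: hv.
have [y yw] : exists y : 'rV[F]_k, y *m w = 1%:M by apply: dual_vec; case: hw.
have [xi xiE] := hw_functional z pr hv.
have [eta etaE] := hw_functional y ps hw.
have id_low : lower_unitriangular (1%:M : 'M[F]_N).
  by split=> [|i]; [apply: scalar_mx_is_trig | rewrite mxE eqxx].
apply: (gl_iso_of_coefficient (xi := xi) (eta := eta) (v := v) (w := w)) => //.
  have := xiE 1%:M id_low; rewrite gl_fun1 mul1mx zv => ->.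
  exact: oner_neq0.
have bigcell (l u : 'M[F]_N) (t : 'rV[F]_N) : lower_unitriangular l -> upper_unitriangular u ->
    (forall i, t 0 i != 0) ->
    xi *m (rho (l *m diag_mx t *m u) *m v) = eta *m (sg (l *m diag_mx t *m u) *m w).
  move=> Ll Uu nzt.
  have Ul := lower_unitriangular_unit Ll; have U_u := upper_unitriangular_unit Uu.
  have Ut := diag_mx_unit nzt.
  rewrite !gl_funM ?unitmx_mul ?Ul ?Ut // -!mulmxA.
  case: hv hw => _ upv wtv [_ upw wtw].
  rewrite upv // upw // wtv // wtw // -!scalemxAr.
  by rewrite xiE // etaE // zv yw.
move=> g Ug.
have [B1 B1E] := pr (shift_mx g); have [B2 B2E] := ps (shift_mx g).
have [d nz_d dP] := LDU_generic g.
suff E : map_mx polyC xi *m (B1 *m map_mx polyC v) =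
         map_mx polyC eta *m (B2 *m map_mx polyC w).
  have U0 : eval_mx 0 (shift_mx g) \in unitmx by rewrite eval_shift_mx raddf0 add0r.
  have := congr1 (eval_mx 0) E; rewrite !eval_mxM !eval_mxC B1E // B2E //.
  by rewrite eval_shift_mx raddf0 add0r.
apply: (@eval_mx_eq_generic _ _ _ (d * char_poly (- g))).
  by rewrite mulf_neq0 ?char_poly_neq0.
move=> x; rewrite hornerM mulf_eq0 negb_or => /andP[/dP[l [u [t [Ll Uu nzt E]]]]].
move=> /shift_mx_unit Ux; rewrite !eval_mxM !eval_mxC B1E ?B2E ?eval_shift_mx //.
by rewrite E bigcell.
Qed.

(** * Homomorphisms out of a cyclic module *)

Lemma dim_limg_mulmxr (F : fieldType) m n (Y : 'M[F]_(m, n)) :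
  \dim (limg (linfun (mulmxr Y : 'rV[F]_m -> 'rV[F]_n))) = \rank Y.
Proof.
pose g : 'Hom('rV[F]_(\rank Y), 'rV[F]_n) := linfun (mulmxr (row_base Y)).
have -> : limg (linfun (mulmxr Y : 'rV[F]_m -> 'rV[F]_n)) = limg g.
  apply/vspaceP => w; apply/memv_imgP/memv_imgP => [[u _ ->]|[u _ ->]]; rewrite lfunE /=.
    have : (u *m Y <= row_base Y)%MS by apply: submx_trans (submxMl _ _) _; rewrite eq_row_base.
    by case/submxP=> a ->; exists a; rewrite ?memvf // lfunE.
  have : (u *m row_base Y <= Y)%MS by apply: submx_trans (submxMl _ _) _; rewrite eq_row_base.
  by case/submxP=> a ->; exists a; rewrite ?memvf // lfunE.
rewrite limg_dim_eq ?dimvf ?dim_matrix; first exact: mul1n.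
apply/eqP; rewrite -subv0; apply/subvP => u; rewrite memv_cap memvf memv_ker lfunE /=.
by rewrite memv0 mulmx_free_eq0 ?row_base_free.
Qed.

Section HomCyclic.

Variables (F : numFieldType) (gT : finGroupType) (G : {group gT}).
Variables (m : nat) (rW : mx_representation F G m).
Let aG := regular_repr F G.

Lemma gring_mx_delta x : x \in G -> gring_mx rW (delta_mx 0 (gring_index G x)) = rW x.
Proof. by move=> Gx; rewrite /gring_mx /= -rowE rowK mxvecK gring_indexK. Qed.

(** The regular module is free on the basis vector of the identity, so an intertwiner is determined
    by the image of that vector. *)
Lemma regular_intertwiner (B : 'M[F]_(#|G|, m)) (a : 'rV_#|G|) :
  (forall x, x \in G -> aG x *m B = B *m rW x) ->
  a *m B = row (gring_index G 1) B *m gring_mx rW a.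
Proof.
move=> homB; rewrite [in LHS](row_sum_delta a) [in RHS](row_sum_delta a).
rewrite linear_sum mulmx_suml mulmx_sumr; apply: eq_bigr => j _.
rewrite linearZ /= -scalemxAl -scalemxAr; congr (_ *: _).
rewrite -[j](gring_valK j) gring_mx_delta ?enum_valP // -row_mul -homB ?enum_valP //.
by rewrite row_mul rowK gring_indexK // mul1g.
Qed.

(* By complete reducibility, maps from the cyclic module extend to the regular
   module, so evaluation at [y] identifies them with the image of [y] on W. *)
Lemma dim_Hom_cyclic (y : 'rV[F]_#|G|) :
  \dim (Hom_repr (submod_repr (cyclic_mx_module aG y)) rW) = \rank (gring_mx rW y).
Proof.
set Umod := cyclic_mx_module aG y; pose U := cyclic_mx aG y.
have [] := @mx_Maschke_pchar F gT G _ aG _ U Umod (submx1 U).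
  by rewrite /pgroup.pgroup GRing.pcharf'_nat pnatr_eq0 -lt0n cardG_gt0.
move=> W Wmod UW /mxdirect_addsP dxUW.
have homP x : x \in G -> aG x *m proj_mx U W = proj_mx U W *m aG x.
  (* [hom_mxP] gives the identity only after multiplication by [U + W] on the left; this sum is the
     whole space, so [K] cancels it. *)
  move=> Gx; have /hom_mxP/(_ x Gx) := proj_mx_hom dxUW Umod Wmod.
  have /(submxP (A := 1%:M))[K K1] : (1%:M <= U + W)%MS by rewrite UW.
  by move/(congr1 (mulmx K)); rewrite !mulmxA -K1 !mul1mx.
pose yU := in_submod U y.
have yUE : yU *m val_submod 1%:M = y by rewrite -val_submodE in_submodK ?cyclic_mx_id.
pose Q := in_submod U (proj_mx U W).
have homQ x : x \in G -> aG x *m Q = Q *m submod_repr Umod x.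
  move=> Gx; rewrite /Q [in LHS]in_submodE mulmxA homP // -in_submodE in_submodJ //.
  by rewrite -[proj_mx U W]mul1mx proj_mx_sub.
have QE p (a : 'M_(p, _)) : (a <= U)%MS -> a *m Q = in_submod U a.
  by move=> aU; rewrite /Q in_submodE mulmxA proj_mx_id // -in_submodE.
(* Extension of [A] by zero on the complement [W]. *)
pose ext (A : 'M_(\rank U, m)) := Q *m A.
have extP A : A \in Hom_repr (submod_repr Umod) rW ->
    forall x, x \in G -> aG x *m ext A = ext A *m rW x.
  move=> /mem_Hom_repr homA x Gx; rewrite /ext mulmxA homQ //.
  rewrite -[LHS]mulmxA -[RHS]mulmxA; congr (_ *m _); exact: homA.
have extE A p (a : 'M_(p, _)) : (a <= U)%MS -> a *m ext A = in_submod U a *m A.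
  by move=> aU; rewrite /ext mulmxA QE.
(* Evaluation at [y]; its image and its kernel on the space of intertwiners remain to be found. *)
pose f : 'Hom('M[F]_(\rank U, m), 'rV[F]_m) := linfun (mulmx yU).
rewrite -[RHS]dim_limg_mulmxr -[LHS](@limg_dim_eq _ _ _ f).
  congr (\dim _); apply/vspaceP => w; apply/memv_imgP/memv_imgP.
    case=> A homA ->; exists (row (gring_index G 1) (ext A)); rewrite ?memvf // !lfunE /=.
    rewrite -regular_intertwiner; last exact: extP.
    by rewrite extE ?cyclic_mx_id.
  case=> z _ ->; rewrite lfunE /=.
  (* The intertwiner from the regular module that sends the identity to [z]; its restriction to [U]
     is the required preimage. *)
  pose B : 'M_(#|G|, m) := \matrix_i (z *m rW (enum_val i)).
  have homB x : x \in G -> aG x *m B = B *m rW x.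
    move=> Gx; apply/row_matrixP => i; rewrite !row_mul !rowK -rowE rowK -mulmxA.
    by rewrite gring_indexK ?groupM ?enum_valP // repr_mxM ?enum_valP.
  exists (val_submod 1%:M *m B).
    apply/mem_Hom_repr => x Gx; rewrite [LHS]mulmxA -[RHS]mulmxA -homB // [RHS]mulmxA.
    congr (_ *m B).
    by rewrite -[LHS]val_submodE -[RHS](val_submodJ Umod) // mul1mx.
  rewrite lfunE /= mulmxA yUE regular_intertwiner // rowK gring_indexK //.
  by rewrite repr_mx1 mulmx1.
apply/eqP; rewrite -subv0; apply/subvP => A; rewrite memv_cap memv_ker lfunE /= memv0.
case/andP=> homA /eqP yA0.
(* The kernel of an intertwiner is a submodule; containing [y], it contains the cyclic module. *)
have kerA : (U <= kermx (ext A))%MS.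
  apply: cyclic_mx_sub; last by apply/sub_kermxP; rewrite extE ?cyclic_mx_id.
  apply/mxmoduleP => x Gx; apply/sub_kermxP.
  by rewrite -mulmxA extP // mulmxA mulmx_ker mul0mx.
have /sub_kermxP := submx_trans (val_submodP (1%:M : 'M_(\rank U))) kerA.
by rewrite extE ?val_submodP // val_submodK mul1mx => ->.
Qed.

End HomCyclic.

(** * Supports of vectors *)

Definition permT (F : fieldType) N (s : 'S_N) : 'M[F]_N := (perm_mx s)^T.
Arguments permT {F N} s.

Lemma permTM (F : fieldType) N (s t : 'S_N) : permT (s * t)%g = permT t *m permT s :> 'M[F]_N.
Proof. by rewrite /permT perm_mxM trmx_mul. Qed.

Lemma permT_unit (F : fieldType) N (s : 'S_N) : permT s \in @unitmx F N.
Proof. by rewrite unitmx_tr unitmx_perm. Qed.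

Lemma permTE (F : fieldType) N (s : 'S_N) i j : permT s i j = (i == s j)%:R :> F.
Proof. by rewrite !mxE eq_sym. Qed.

Definition row_symm (F : fieldType) N m nu (f : 'M[F]_N -> 'M[F]_m) : 'M[F]_m :=
  \sum_(p in row_stab N nu) f (permT p).

Definition col_antisymm (F : fieldType) N m nu (f : 'M[F]_N -> 'M[F]_m) : 'M[F]_m :=
  \sum_(q in col_stab N nu) (-1) ^+ odd_perm q *: f (permT q).

(** The symmetrizer consists of the terms [q * p], and [permT] reverses products, so it acts on
    columns as the row symmetrizer after the column antisymmetrizer. Transposition to the row
    convention keeps the rank. *)
Lemma dim_Hom_specht (F : numFieldType) N m nu (rho : gl_rep F N m) :
  \dim (Hom_repr (specht F N nu) (perm_restr rho)) =
  \rank (row_symm nu rho *m col_antisymm nu rho).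
Proof.
rewrite dim_Hom_cyclic -mxrank_tr; congr (\rank _).
rewrite /young_symmetrizer linear_sum [LHS]raddf_sum /row_symm mulmx_suml.
apply: eq_bigr => p _; rewrite linear_sum [LHS]raddf_sum mulmx_sumr.
apply: eq_bigr => q _; rewrite linearZ /= linearZ /= -scalemxAr.
rewrite gring_mx_delta ?inE //= /perm_restr_fun trmxK -/(permT _) permTM.
by rewrite gl_funM ?permT_unit.
Qed.

Definition proj (F : fieldType) N (T : {set 'I_N}) : 'M[F]_N :=
  diag_mx (\row_i (i \in T)%:R).
Arguments proj {F N} T.

Lemma projE (F : fieldType) N (T : {set 'I_N}) i j :
  proj T i j = ((i == j) && (i \in T))%:R :> F.
Proof. by rewrite !mxE; case: eqP => [->|]; rewrite ?mulr1n ?mulr0n. Qed.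

Lemma projM (F : fieldType) N (J T : {set 'I_N}) : proj J *m proj T = proj (J :&: T) :> 'M[F]_N.
Proof.
apply/matrixP=> i j; rewrite mul_diag_mx !mxE inE.
by case: eqP => [->|]; rewrite ?mulr0n ?mulr0 // !mulr1n -natrM mulnb.
Qed.

Lemma projT (F : fieldType) N : proj setT = 1%:M :> 'M[F]_N.
Proof. by apply/matrixP=> i j; rewrite projE !mxE inE andbT. Qed.

Lemma permT_proj (F : fieldType) N (s : 'S_N) (T : {set 'I_N}) :
  permT s *m proj T = proj (s @: T) *m permT s :> 'M[F]_N.
Proof.
apply/matrixP=> i j; rewrite mul_diag_mx mul_mx_diag [LHS]mxE [RHS]mxE !permTE !mxE.
case: eqP => [->|_]; last by rewrite mulr0 mul0r.
by rewrite (mem_imset _ _ (@perm_inj _ s)) mulr1 mul1r.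
Qed.

Lemma permT_proj_id (F : fieldType) N (s : 'S_N) (T : {set 'I_N}) :
  {in T, forall i, s i = i} -> permT s *m proj T = proj T :> 'M[F]_N.
Proof.
move=> sT; apply/matrixP=> i j; rewrite mul_mx_diag [LHS]mxE permTE !mxE.
case jT: (j \in T); last by rewrite mulr0; case: eqP => [->|]; rewrite ?mulr0n // jT.
by rewrite mulr1 sT //; case: eqP => [->|]; rewrite ?mulr0n // jT.
Qed.

(** Scalar matrices are central, so the eigenspace containing the highest weight vector is stable
    and hence everything. The bound on [size lam] ensures that all parts of [lam] occur in the
    weight. *)
Lemma hw_scalar (F : numFieldType) N m lam (rho : gl_rep F N m) x :
  irr_poly_gl_rep lam rho -> (size lam <= N)%N -> x != 0 ->
  rho x%:M = (x ^+ sumn lam)%:M.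
Proof.
move=> [_ irr [v [nz_v _ wtv]]] lamN nz_x.
have Ux : x%:M \in @unitmx F N by rewrite unitmxE unitfE det_scalar expf_neq0.
have vE : rho x%:M *m v = x ^+ sumn lam *: v.
  rewrite -diag_const_mx wtv => [|i]; last by rewrite mxE.
  congr (_ *: v); under eq_bigr => i _ do rewrite mxE.
  rewrite prodrXr; congr (x ^+ _).
  rewrite sumnE (big_nth 0%N) big_mkord (big_ord_widen N (nth 0%N lam)) //.
  rewrite [LHS](bigID (fun i : 'I_N => i < size lam)%N) /= [X in (_ + X)%N]big1 ?addn0 //.
  by move=> i; rewrite -leqNgt => /(nth_default 0%N).
have [|||all|all] := gl_irr_pred (P := fun y => rho x%:M *m y = x ^+ sumn lam *: y) irr.
- by rewrite mulmx0 scaler0.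
- by move=> a y y' E E'; rewrite mulmxDr -scalemxAr E E' scalerDr !scalerA mulrC.
- move=> g y Ug E; rewrite mulmxA -gl_funM // -scalar_mxC gl_funM // -mulmxA E.
  by rewrite -scalemxAr.
- by case/eqP: nz_v; apply: all.
apply/matrixP => i j; have := all (delta_mx j 0).
by rewrite -colE => /matrixP/(_ i 0); rewrite !mxE andbT mulr_natr.
Qed.

(** * Decomposition of a polynomial representation by supports *)

Section Support.

Variables (F : numFieldType) (N m d : nat) (sg : 'M[F]_N -> 'M[F]_m).
Hypothesis sgM : forall g h, sg (g *m h) = sg g *m sg h.
Hypothesis sgP : forall i j, exists p : mpoly (N * N) F,
  forall g, sg g i j = meval (fun k => mxvec g 0 k) p.
Hypothesis sgZ : forall x, x != 0 -> sg x%:M = (x ^+ d)%:M.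

(** At a diagonal matrix only monomials in the diagonal entries survive; this is the set of the
    diagonal entries that occur. *)
Definition mon_supp (mon : multinom (N * N)) : {set 'I_N} :=
  [set i | fun_of_multinom mon (mxvec_index i i) != 0%N].

Definition mon_diag (mon : multinom (N * N)) : bool :=
  [forall i : 'I_N, forall j : 'I_N,
     (i != j) ==> (fun_of_multinom mon (mxvec_index i j) == 0%N)].

Lemma mon_eval_proj (mon : multinom (N * N)) T x :
  \prod_k (mxvec (x%:M *m proj T) 0 k) ^+ fun_of_multinom mon k =
  (mon_diag mon && (mon_supp mon \subset T))%:R * x ^+ mdeg mon :> F.
Proof.
have entE (i j : 'I_N) : (x%:M *m proj T) i j = x * ((i == j) && (i \in T))%:R.
  by rewrite mul_scalar_mx mxE projE.
case: (boolP (mon_diag mon && _)) => [/andP[/forallP dia /subsetP sup]|].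
  rewrite mul1r mdegE -prodrXr; apply: eq_bigr => k _.
  case/mxvec_indexP: k => i j; rewrite mxvecE entE.
  case: (eqVneq (fun_of_multinom mon (mxvec_index i j)) 0%N) => [->|nz]; first by rewrite !expr0.
  have := forallP (dia i) j; case: (eqVneq i j) => [ij|]; last by rewrite (negPf nz).
  by subst j; rewrite /= sup ?mulr1 // inE.
move=> bad; rewrite mul0r.
suff [i [j [nz out]]] : exists i j, fun_of_multinom mon (mxvec_index i j) != 0%N /\
    ~~ ((i == j) && (i \in T)).
  rewrite (bigD1 (mxvec_index i j)) //= mxvecE entE (negPf out) mulr0.
  by rewrite expr0n (negPf nz) mul0r.
move: bad; rewrite negb_and => /orP[|/subsetPn[k]].
  case/forallPn => i /forallPn[j]; rewrite negb_imply => /andP[ij nz].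
  by exists i, j; rewrite (negPf ij).
by rewrite inE => nz kT; exists k, k; rewrite eqxx.
Qed.

Lemma card_mon_supp mon : (#|mon_supp mon| <= mdeg mon)%N.
Proof.
rewrite mdegE (reindex _ (curry_mxvec_bij _ _)) /=.
rewrite (eq_bigr (fun ij => fun_of_multinom mon (mxvec_index ij.1 ij.2))) => [|[]//].
rewrite -(pair_bigA _ (fun i j => fun_of_multinom mon (mxvec_index i j))) /=.
rewrite -sum1_card big_mkcond /=; apply: leq_sum => i _.
rewrite (bigD1 i) //=; case: ifP => // iS; apply: leq_trans (leq_addr _ _).
by move: iS; rewrite inE lt0n.
Qed.

(** [X S] collects the diagonal monomials of degree [d] whose support is exactly [S]; a monomial of
    degree [d] involves at most [d] coordinates. *)
Lemma support_decomp : exists X : {set 'I_N} -> 'M[F]_m,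
  (forall T, sg (proj T) = \sum_(S : {set 'I_N} | S \subset T) X S) /\
  (forall S : {set 'I_N}, (d < #|S|)%N -> X S = 0).
Proof.
have [h hE] := choice (fun ij : 'I_m * 'I_m => sgP ij.1 ij.2).
pose good S mon := [&& mon_diag mon, mon_supp mon == S & mdeg mon == d].
exists (fun S => \matrix_(i, j) \sum_(mon <- msupp (h (i, j)) | good S mon) mcoeff mon (h (i, j))).
split=> [T|S dS]; apply/matrixP=> i j; last first.
  rewrite !mxE big1 // => mon /and3P[_ /eqP SE /eqP dE].
  by move: dS; rewrite -SE -dE ltnNge card_mon_supp.
rewrite summxE; under [RHS]eq_bigr => S _ do rewrite mxE.
set p := h (i, j).
(* An entry of [sg] along [x%:M *m proj T]. By homogeneity it is a multiple of ['X^d], so the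
   monomials of other degrees contribute nothing in total. *)
pose q : {poly F} := \sum_(mon <- msupp p)
  (mcoeff mon p * (mon_diag mon && (mon_supp mon \subset T))%:R) *: 'X^(mdeg mon).
have qE : q = sg (proj T) i j *: 'X^d.
  apply: (@poly_eq_generic _ 'X); first by rewrite polyX_eq0.
  move=> x; rewrite hornerX => nz_x.
  rewrite hornerZ hornerXn.
  have -> : sg (proj T) i j * x ^+ d = sg (x%:M *m proj T) i j.
    by rewrite sgM sgZ // mul_scalar_mx mxE mulrC.
  rewrite (hE (i, j)) -/p mevalE horner_sum; apply: eq_bigr => mon _.
  by rewrite mon_eval_proj hornerZ hornerXn mulrA.
have := congr1 (coefp d) qE; rewrite /= coefZ coefXn eqxx mulr1 => <-.
rewrite /q coef_sum.
rewrite (exchange_big_dep (fun mon =>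
  (mdeg mon == d) && (mon_diag mon && (mon_supp mon \subset T)))) /=; last first.
  by move=> S mon ST /and3P[-> /eqP-> ->].
rewrite [RHS]big_mkcond /=; apply: eq_bigr => mon _.
rewrite coefZ coefXn [d == _]eq_sym; case: (mdeg mon == d) / eqP => dE; last by rewrite mulr0.
rewrite mulr1; case: ifP => /= [/andP[dia ST]|->]; last by rewrite mulr0.
rewrite dia ST mulr1 (big_pred1 (mon_supp mon)) // => S.
rewrite /good dia dE eqxx /= andbT; case: (eqVneq (mon_supp mon) S) => [<-|].
  by rewrite ST /= ?eqxx.
by rewrite andbF.
Qed.

End Support.

Lemma sub_imset_perm N (s : 'S_N) (S T : {set 'I_N}) :
  (s @: T \subset s @: S) = (T \subset S).
Proof.
apply/idP/idP => [/subsetP TS|]; last exact: imsetS.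
apply/subsetP => i iT; have := TS (s i); rewrite !(mem_imset _ _ (@perm_inj _ s)).
exact.
Qed.

(** * Support components under projections and permutations *)

Section SupportTheory.

Variables (F : fieldType) (N m : nat) (sg : 'M[F]_N -> 'M[F]_m).
Hypothesis sgM : forall g h, sg (g *m h) = sg g *m sg h.
Variable X : {set 'I_N} -> 'M[F]_m.
Hypothesis sgX : forall T, sg (proj T) = \sum_(S : {set 'I_N} | S \subset T) X S.

(** Recursive Möbius inversion: it reduces statements about [X S] to [proj S] and to smaller
    supports. *)
Lemma support_part_rec S :
  X S = sg (proj S) - \sum_(T : {set 'I_N} | (T \subset S) && (T != S)) X T.
Proof. by rewrite sgX (bigD1 S) //= addrK. Qed.

Lemma support_part_ind (P : {set 'I_N} -> Prop) :
  (forall S : {set 'I_N}, (forall T : {set 'I_N}, T \subset S -> T != S -> P T) -> P S) ->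
  forall S, P S.
Proof.
move=> PS S; have [k] := ubnP #|S|; elim: k S => // k IHk S ltSk.
apply: PS => T TS neTS; apply: IHk; rewrite ltnS in ltSk; apply: leq_trans ltSk.
by rewrite proper_card // properEneq neTS.
Qed.

Lemma support_part_right S J : X S *m sg (proj J) = if S \subset J then X S else 0.
Proof.
elim/support_part_ind: S => S IH; rewrite {1}support_part_rec mulmxBl -sgM projM mulmx_suml.
rewrite (eq_bigr (fun T : {set 'I_N} => if T \subset J then X T else 0)); last first.
  by move=> T /andP[TS nTS]; exact: IH.
case: ifP => [SJ|nSJ].
  rewrite (setIidPl SJ) [RHS]support_part_rec; congr (_ - _); apply: eq_bigr => T /andP[TS _].
  by rewrite (subset_trans TS SJ).
(* If [S] is not inside [J], the subsets of [S :&: J] are exactly the proper subsets of [S]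
   contained in [J], so the two sums cancel. *)
rewrite sgX -big_mkcondr; apply/eqP; rewrite subr_eq0; apply/eqP/eq_bigl => T.
rewrite subsetI -andbA; case: (T \subset S) => //=.
case TJ: (T \subset J); rewrite ?andbF ?andbT //.
by symmetry; apply: contraFneq nSJ => <-.
Qed.

Lemma support_part_left S J : sg (proj J) *m X S = if S \subset J then X S else 0.
Proof.
elim/support_part_ind: S => S IH; rewrite {1}support_part_rec mulmxBr -sgM projM mulmx_sumr.
rewrite (eq_bigr (fun T : {set 'I_N} => if T \subset J then X T else 0)); last first.
  by move=> T /andP[TS nTS]; exact: IH.
case: ifP => [SJ|nSJ].
  rewrite (setIidPr SJ) [RHS]support_part_rec; congr (_ - _); apply: eq_bigr => T /andP[TS _].
  by rewrite (subset_trans TS SJ).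
rewrite sgX -big_mkcondr; apply/eqP; rewrite subr_eq0; apply/eqP/eq_bigl => T.
rewrite subsetI andbC -andbA; case: (T \subset S) => //=.
case TJ: (T \subset J); rewrite ?andbF ?andbT //.
by symmetry; apply: contraFneq nSJ => <-.
Qed.

(** Conjugation by a permutation matrix permutes the coordinate projections, hence the components
    that they determine. *)
Lemma support_part_perm (s : 'S_N) S : sg (permT s) *m X S = X (s @: S) *m sg (permT s).
Proof.
have injs : injective (fun S : {set 'I_N} => s @: S) := imset_inj (@perm_inj _ s).
elim/support_part_ind: S => S IH; rewrite {1}support_part_rec mulmxBr -sgM permT_proj sgM.
rewrite [X (s @: S)]support_part_rec mulmxBl; congr (_ - _).
rewrite mulmx_sumr mulmx_suml.
rewrite [RHS](reindex_inj injs); apply: eq_big => [T|T /andP[TS nTS]]; last exact: IH.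
by rewrite (inj_eq injs) sub_imset_perm.
Qed.

Lemma sum_support_part : sg 1%:M = \sum_S X S.
Proof. by rewrite -projT sgX; apply: eq_bigl => S; rewrite subsetT. Qed.

End SupportTheory.

(** * Restriction to one variable less *)

Definition polyfun (F : fieldType) N (f : 'M[F]_N -> F) : Prop :=
  exists p : mpoly (N * N) F, forall g, f g = meval (fun k => mxvec g 0 k) p.

Lemma polyfun_sum (F : fieldType) N (I : finType) (f : I -> 'M[F]_N -> F) :
  (forall i, polyfun (f i)) -> polyfun (fun g => \sum_i f i g).
Proof.
move=> fP; have [h hE] := choice fP.
by exists (\sum_i h i) => g; rewrite rmorph_sum; apply: eq_bigr => i _; rewrite hE.
Qed.

Lemma polyfunZ (F : fieldType) N (a : F) (f : 'M[F]_N -> F) :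
  polyfun f -> polyfun (fun g => a * f g).
Proof. by case=> p pE; exists (a *: p) => g; rewrite mevalZ pE. Qed.

Lemma polyfun_entry (F : fieldType) N (i j : 'I_N) : polyfun (fun g : 'M[F]_N => g i j).
Proof. by exists (mpolyX F (mnm1 (mxvec_index i j))) => g; rewrite mevalXU mxvecE. Qed.

Lemma polyfun_mulmx (F : fieldType) N a b c d (A : 'M[F]_(a, b)) (f : 'M[F]_N -> 'M[F]_(b, c))
    (D : 'M[F]_(c, d)) :
  (forall i j, polyfun (fun g => f g i j)) ->
  forall i j, polyfun (fun g => (A *m f g *m D) i j).
Proof.
move=> fP i j.
have [p pE] : polyfun (fun g => \sum_k D k j * \sum_l A i l * f g l k).
  by apply: polyfun_sum => k; apply/polyfunZ/polyfun_sum => l; apply: polyfunZ.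
exists p => g; rewrite -pE mxE; apply: eq_bigr => k _; rewrite mulrC; congr (_ * _).
by rewrite mxE.
Qed.

Lemma polyfun_comp (F : fieldType) N M (h : 'M[F]_N -> 'M[F]_M) (f : 'M[F]_M -> F) :
  (forall i j, polyfun (fun g => h g i j)) -> polyfun f -> polyfun (fun g => f (h g)).
Proof.
move=> hP [p pE].
have hk k : polyfun (fun g => mxvec (h g) 0 k).
  case/mxvec_indexP: k => i j; have [q qE] := hP i j; exists q => g.
  by rewrite mxvecE.
have [q qE] := choice hk.
exists (comp_mpoly [tuple q k | k < M * M] p) => g.
rewrite comp_mpoly_meval pE; congr (meval _ p); apply/funext => k.
by rewrite tnth_mktuple qE.
Qed.

(** Membership in a subspace becomes a system of linear equations, to which density arguments
    apply. *)
Lemma vspace_kermx (F : fieldType) m (U : {vspace 'cV[F]_m}) :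
  exists D : 'M[F]_m, forall x, x \in U <-> D *m x = 0.
Proof.
pose L : 'End('cV[F]_m) := (\1 - projv U)%VF.
exists (lin1_mx (@trmx F m 1 \o (L \o @trmx F 1 m)))^T => x.
have -> : (lin1_mx (@trmx F m 1 \o (L \o @trmx F 1 m)))^T *m x = L x.
  by apply: trmx_inj; rewrite trmx_mul trmxK mul_rV_lin1 /= trmxK.
have -> : L x = x - projv U x by rewrite /L !lfunE /= !lfunE.
split=> [/projv_id ->|/eqP]; first by rewrite subrr.
by rewrite subr_eq0 => /eqP ->; apply: memv_proj.
Qed.

(** The inclusion of coordinate spaces that skips [z]. Conjugation by it extends a matrix by a zero
    row and a zero column at [z], so the identity goes to a projection. *)
Definition insert (F : fieldType) N (z : 'I_N.+1) : 'M[F]_(N.+1, N) :=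
  \matrix_(i, j) (i == lift z j)%:R.
Arguments insert F {N} z.

Lemma insertTK (F : fieldType) N (z : 'I_N.+1) : (insert F z)^T *m insert F z = 1%:M.
Proof.
apply/matrixP=> i j; rewrite !mxE (bigD1 (lift z i)) //= !mxE eqxx mul1r.
rewrite (inj_eq lift_inj) big1 ?addr0 // => k /negPf nk.
by rewrite !mxE nk mul0r.
Qed.

Lemma insert_conj_lift (F : fieldType) N (z : 'I_N.+1) (g : 'M[F]_N) i j :
  (insert F z *m g *m (insert F z)^T) (lift z i) (lift z j) = g i j.
Proof.
rewrite mxE (bigD1 j) //= !mxE eqxx mulr1 (bigD1 i) //= !mxE eqxx mul1r.
rewrite big1 ?addr0 => [|k /negPf nk]; last by rewrite !mxE (inj_eq lift_inj) eq_sym nk mul0r.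
rewrite big1 ?addr0 // => k /negPf nk.
by rewrite !mxE (inj_eq lift_inj) [j == k]eq_sym nk mulr0.
Qed.

Lemma insert_conj_outl (F : fieldType) N (z : 'I_N.+1) (g : 'M[F]_N) j :
  (insert F z *m g *m (insert F z)^T) z j = 0.
Proof.
rewrite mxE big1 // => k _; rewrite !mxE big1 ?mul0r // => l _.
by rewrite !mxE (negPf (neq_lift _ _)) mul0r.
Qed.

Lemma insert_conj_outr (F : fieldType) N (z : 'I_N.+1) (g : 'M[F]_N) i :
  (insert F z *m g *m (insert F z)^T) i z = 0.
Proof.
rewrite mxE big1 // => k _.
by rewrite !mxE (negPf (neq_lift _ _)) mulr0.
Qed.

Lemma insert_conj1 (F : fieldType) N (z : 'I_N.+1) :
  insert F z *m 1%:M *m (insert F z)^T = proj [set~ z].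
Proof.
apply/matrixP => i j; rewrite projE !inE.
case: (unliftP z i) => [i'|] ->; last by rewrite insert_conj_outl eqxx andbF.
case: (unliftP z j) => [j'|] ->; last by rewrite insert_conj_outr; case: eqP => // ->; rewrite eqxx.
by rewrite insert_conj_lift mxE (inj_eq lift_inj) [_ == z]eq_sym (negPf (neq_lift _ _)) andbT.
Qed.

Lemma insert_conjM (F : fieldType) N (z : 'I_N.+1) (g h : 'M[F]_N) :
  insert F z *m (g *m h) *m (insert F z)^T =
  (insert F z *m g *m (insert F z)^T) *m (insert F z *m h *m (insert F z)^T).
Proof. by rewrite !mulmxA -(mulmxA _ _ (insert F z)) insertTK mulmx1. Qed.

Lemma proj_insert (F : fieldType) N (z : 'I_N.+1) : proj [set~ z] *m insert F z = insert F z.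
Proof. by rewrite -insert_conj1 mulmx1 -mulmxA insertTK mulmx1. Qed.

Lemma permT_lift_insert (F : fieldType) N (z z' : 'I_N.+1) (s : 'S_N) :
  permT (lift_perm z z' s) *m insert F z = insert F z' *m permT s.
Proof.
apply/matrixP => i j; rewrite !mxE (bigD1 (lift z j)) //= permTE [X in _ * X]mxE eqxx mulr1.
rewrite lift_perm_lift big1 ?addr0 => [|k /negPf nk]; last by rewrite [X in _ * X]mxE nk mulr0.
rewrite (bigD1 (s j)) //= permTE [X in X * _]mxE eqxx mulr1.
by rewrite big1 ?addr0 // => k /negPf nk; rewrite permTE nk mulr0.
Qed.

Lemma permT_lift_proj (F : fieldType) N (z : 'I_N.+1) (s : 'S_N) :
  permT (lift_perm z z s) *m proj [set~ z] = insert F z *m permT s *m (insert F z)^T.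
Proof. by rewrite -insert_conj1 mulmx1 mulmxA permT_lift_insert. Qed.

Lemma eval_line_mx (F : fieldType) m n (A B : 'M[F]_(m, n)) (x : F) :
  eval_mx x (map_mx polyC A + 'X *: map_mx polyC B) = A + x *: B.
Proof. by apply/matrixP=> i j; rewrite !mxE /horner_eval !hornerE. Qed.

(** In a rank factorization of an idempotent, the columns form a basis of the image and the rows
    give coordinates on it. *)
Lemma idempotent_factor (F : fieldType) m (E : 'M[F]_m) : E *m E = E ->
  row_base E *m col_base E = 1%:M.
Proof.
move=> EE; have CRC : col_base E *m (row_base E *m col_base E) = col_base E.
  apply: (can_inj (mulmxKp (row_base_free E))).
  rewrite -(mulmxA (col_base E)) -(mulmxA (row_base E)) mulmx_base.
  by rewrite (mulmxA (col_base E) (row_base E)) mulmx_base EE.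
by rewrite -[LHS]mul1mx -(mulVpmx (col_base_full E)) -mulmxA CRC.
Qed.

(** * The GL(N)-module of vectors whose support avoids [z] *)

Section Truncation.

Variables (F : numFieldType) (N m : nat) (lam : seq nat) (rho : gl_rep F N.+1 m).
Hypothesis irr_rho : irr_poly_gl_rep lam rho.
Hypothesis lamN : (size lam <= N)%N.
Variable sg : 'M[F]_N.+1 -> 'M[F]_m.
Hypothesis sg_rho : forall g, g \in unitmx -> sg g = rho g.
Hypothesis sgM : forall g h, sg (g *m h) = sg g *m sg h.
Hypothesis sgP : forall i j, polyfun (fun g => sg g i j).
Variable z : 'I_N.+1.

Let E := sg (proj [set~ z]).
Variables (k : nat) (C : 'M[F]_(m, k)) (R : 'M[F]_(k, m)).
Hypothesis CR : C *m R = E.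
Hypothesis RC : R *m C = 1%:M.
Let emb (g : 'M[F]_N) := insert F z *m g *m (insert F z)^T.

Let RE : R *m E = R.
Proof. by rewrite -CR mulmxA RC mul1mx. Qed.

Let EC : E *m C = C.
Proof. by rewrite -CR -mulmxA RC mulmx1. Qed.

Let sg_emb g : E *m sg (emb g) = sg (emb g).
Proof. by rewrite -sgM /emb !mulmxA proj_insert. Qed.

Let emb_sg g : sg (emb g) *m E = sg (emb g).
Proof. by rewrite -sgM /emb -insert_conj1 -insert_conjM mulmx1. Qed.

(** The action on the image of [E], with [C] as the inclusion of this image and [R] as the
    projection onto it. *)
Definition trunc_fun (g : 'M[F]_N) : 'M[F]_(k) := R *m sg (emb g) *m C.

Lemma trunc_fun1 : trunc_fun 1%:M = 1%:M.
Proof. by rewrite /trunc_fun /emb insert_conj1 -/E -CR mulmxA RC mul1mx RC. Qed.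

Lemma trunc_funM g h : trunc_fun (g *m h) = trunc_fun g *m trunc_fun h.
Proof.
rewrite /trunc_fun /emb insert_conjM sgM -/(emb g) -/(emb h) -{1}(emb_sg g) -CR.
by rewrite !mulmxA.
Qed.

Definition trunc_rep : gl_rep F N (k) :=
  GlRep trunc_fun1 (fun g h _ _ => trunc_funM g h).

Lemma trunc_col g : C *m trunc_rep g = sg (emb g) *m C.
Proof. by rewrite /= /trunc_fun !mulmxA CR sg_emb. Qed.

Lemma trunc_row g : trunc_rep g *m R = R *m sg (emb g).
Proof. by rewrite /= /trunc_fun -[LHS]mulmxA CR -[LHS]mulmxA emb_sg. Qed.

Lemma trunc_polyfun i j : polyfun (fun g => trunc_rep g i j).
Proof.
apply: polyfun_mulmx => a b; apply: (@polyfun_comp _ _ _ emb (fun g => sg g a b)) => //.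
by apply: polyfun_mulmx => c d; apply: polyfun_entry.
Qed.

Lemma trunc_polynomial : gl_polynomial trunc_rep.
Proof. by move=> i j; have [p pE] := trunc_polyfun i j; exists p => g _; rewrite pE. Qed.

(* By density of the invertible matrices. *)
Lemma stable_all (U : {vspace 'cV[F]_(k)}) :
  (forall g v, g \in unitmx -> v \in U -> trunc_rep g *m v \in U) ->
  forall g v, v \in U -> trunc_rep g *m v \in U.
Proof.
move=> stU g v vU; have [D DP] := vspace_kermx U.
have curve : curve_poly trunc_rep predT.
  by apply: curve_polyW => i j; have [p pE] := trunc_polyfun i j; exists p => h _; rewrite pE.
have [B BE] := curve (shift_mx g).
have B0 : map_mx polyC D *m B *m map_mx polyC v = 0.
  apply: (eval_mx_eq_generic (char_poly_neq0 (- g))) => x /shift_mx_unit Ux.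
  rewrite !eval_mxM !eval_mxC BE // eval_shift_mx -mulmxA.
  rewrite (_ : eval_mx x 0 = 0); last by apply/matrixP=> i j; rewrite !mxE /horner_eval horner0.
  exact/DP/stU.
apply/DP; have := congr1 (eval_mx 0) B0.
rewrite !eval_mxM !eval_mxC BE // eval_shift_mx raddf0 add0r -mulmxA => ->.
by apply/matrixP=> i j; rewrite !mxE /horner_eval horner0.
Qed.

(** For a stable [U], the vectors [w] with every [R *m (sg h *m w)] in [U] form a GL(N+1)-stable
    subspace. It contains [C *m x] for [x] in [U], because [R *m sg h *m C] is the truncated action
    of a compression of [h]. That compression may be singular, whence [stable_all]. *)
Lemma trunc_stable_full (U : {vspace 'cV[F]_(k)}) :
  (forall g v, g \in unitmx -> v \in U -> trunc_rep g *m v \in U) ->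
  U = 0%VS \/ U = fullv.
Proof.
move=> stU; have [_ irr _] := irr_rho.
case: (eqVneq U 0%VS) => [|nzU]; [by left | right].
have [|||all0|all] := gl_irr_pred (P := fun w => forall h, R *m (sg h *m w) \in U) irr.
- by move=> h; rewrite !mulmx0 mem0v.
- by move=> a x y Px Py h; rewrite !mulmxDr -!scalemxAr memvD ?memvZ.
- by move=> g x Ug Px h; rewrite -sg_rho // (mulmxA (sg h)) -sgM.
- have xU := memv_pick U; set x := vpick U in xU.
  have nz_x : x != 0 by rewrite vpick0.
  suff Cx0 : C *m x = 0 by case/eqP: nz_x; rewrite -[x]mul1mx -RC -mulmxA Cx0 mulmx0.
  apply: all0 => h.
  have -> : R *m (sg h *m (C *m x)) = trunc_rep ((insert F z)^T *m h *m insert F z) *m x.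
    rewrite /= /trunc_fun /emb !mulmxA; congr (_ *m x).
    have -> : insert F z *m (insert F z)^T *m h *m insert F z *m (insert F z)^T =
        proj [set~ z] *m h *m proj [set~ z] by rewrite -insert_conj1 mulmx1 !mulmxA.
    by rewrite !sgM -/E -[RHS]mulmxA -(mulmxA _ E) EC !mulmxA RE.
  exact: stable_all.
apply/vspaceP => y; rewrite memvf; have := all (C *m y) 1%:M.
have sg1 : sg 1%:M = 1%:M by rewrite sg_rho ?unitmx1 // gl_fun1.
by rewrite sg1 mul1mx mulmxA RC mul1mx.
Qed.

Lemma sg_permT_inj (s : 'S_N.+1) (x : 'cV[F]_m) : sg (permT s) *m x = 0 -> x = 0.
Proof.
move=> sx0; rewrite -[x]mul1mx -(gl_fun1 rho) -sg_rho ?unitmx1 //.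
have -> : 1%:M = permT s^-1 *m permT s :> 'M[F]_N.+1 by rewrite -permTM mulgV /permT perm_mx1 trmx1.
by rewrite sgM -mulmxA sx0 mulmx0.
Qed.

Lemma trunc_hw : exists v, highest_weight_vector trunc_rep lam v.
Proof.
have [_ _ [v [nz_v upv wtv]]] := irr_rho.
(* Truncation at the last coordinate keeps the highest weight vector. The cycle [c] carries the last
   coordinate to [z] and preserves the order of the others. *)
pose c := lift_perm ord_max z 1 : 'S_N.+1.
pose o : 'I_N.+1 := ord_max.
pose E0 := sg (proj [set~ o]).
have E0v : E0 *m v = v.
  have curve : curve_poly sg predT.
    by apply: curve_polyW => i j; have [p pE] := sgP i j; exists p => h _; rewrite pE.
  (* For [x != 0] this curve lies in the torus and fixes [v], since the last coordinate of the
     weight is 0 by [lamN]; at [x = 0] it is the projection. *)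
  have [B BE] := curve (map_mx polyC (proj [set~ o]) + 'X *: map_mx polyC (proj (~: [set~ o]))).
  have Bv : B *m map_mx polyC v = map_mx polyC v.
    apply: (@eval_mx_eq_generic _ _ _ 'X); first by rewrite polyX_eq0.
    move=> x; rewrite hornerX => nz_x; rewrite !eval_mxM !eval_mxC BE // eval_line_mx.
    pose t : 'rV[F]_N.+1 := \row_i (if i == o then x else 1).
    have tE : proj [set~ o] + x *: proj (~: [set~ o]) = diag_mx t.
      apply/matrixP=> i j; rewrite mxE [X in _ + X]mxE !projE !mxE !inE negbK.
      by case: (eqVneq i j) => [->|]; case: eqP;
        rewrite ?mulr0 ?mulr1 ?addr0 ?add0r ?mulr1n ?mulr0n.
    have nzt i : t 0 i != 0 by rewrite mxE; case: ifP => // _; apply: oner_neq0.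
    rewrite tE sg_rho ?diag_mx_unit // wtv // big_ord_recr /= mxE eqxx nth_default // expr0 mulr1.
    rewrite big1 ?scale1r // => i _; rewrite mxE ifF ?expr1n //.
    by apply/negbTE; rewrite -val_eqE /= ltn_eqF.
  have := congr1 (eval_mx 0) Bv; rewrite !eval_mxM !eval_mxC BE // eval_line_mx.
  by rewrite scale0r addr0.
pose w := sg (permT c) *m v.
have cz : c @: [set~ o] = [set~ z].
  apply/setP=> j; rewrite -[j](permKV c) (mem_imset _ _ (@perm_inj _ c)) !inE.
  by rewrite -[X in _ = ~~ (_ == X)](lift_perm_id o z 1) (inj_eq perm_inj).
have Ew : E *m w = w by rewrite /E /w -cz mulmxA -sgM -permT_proj sgM -mulmxA -/E0 E0v.
have CRw : C *m (R *m w) = w by rewrite mulmxA CR.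
(* The action of [g] on [R *m w] can be read off from any invertible [g'] that agrees with [g] off
   the last coordinate. *)
have act (g : 'M[F]_N) (g' : 'M[F]_N.+1) a : g' \in unitmx ->
    g' *m proj [set~ o] = insert F o *m g *m (insert F o)^T ->
    rho g' *m v = a *: v -> trunc_rep g *m (R *m w) = a *: (R *m w).
  move=> Ug' gE g'v; rewrite mulmxA trunc_row /w -!mulmxA (mulmxA (sg (emb g))) -sgM.
  have -> : emb g *m permT c = permT c *m (g' *m proj [set~ o]).
    rewrite gE !mulmxA permT_lift_insert /permT perm_mx1 trmx1 mulmx1 /emb -!mulmxA.
    congr (_ *m (_ *m _)).
    apply: trmx_inj; rewrite trmx_mul !trmxK.
    have := permT_lift_insert F z o 1; rewrite /permT perm_mx1 trmx1 mulmx1 => <-.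
    congr (_ *m _); rewrite -(trmxK (perm_mx c)) tr_perm_mx /c lift_permV invg1.
    by [].
  by rewrite !sgM -!mulmxA -/E0 E0v (sg_rho Ug') g'v -!scalemxAr.
have proj_out (g : 'M[F]_N) (g' : 'M[F]_N.+1) :
    (forall i j, g' (lift o i) (lift o j) = g i j) -> (forall j, g' o (lift o j) = 0) ->
    g' *m proj [set~ o] = insert F o *m g *m (insert F o)^T.
  move=> gE g0; apply/matrixP => i j; rewrite mul_mx_diag [LHS]mxE [X in _ * X]mxE !inE.
  case: (unliftP o j) => [j'|] ->; last by rewrite eqxx mulr0 insert_conj_outr.
  rewrite eq_sym neq_lift mulr1; case: (unliftP o i) => [i'|] ->.
    by rewrite gE insert_conj_lift.
  by rewrite g0 insert_conj_outl.
exists (R *m w); split.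
- apply: contra nz_v => /eqP Rw0; apply/eqP/(@sg_permT_inj c).
  by rewrite -/w -CRw Rw0 mulmx0.
- move=> u [tu du]; rewrite -[RHS]scale1r.
  pose u' : 'M[F]_N.+1 := insert F o *m u *m (insert F o)^T + proj [set o].
  have u'lift i j : u' (lift o i) (lift o j) = u i j.
    by rewrite mxE insert_conj_lift projE inE [_ == o]eq_sym (negPf (neq_lift _ _)) andbF addr0.
  have u'oj j : u' o (lift o j) = 0.
    by rewrite mxE insert_conj_outl projE (negPf (neq_lift _ _)) addr0.
  have u'io i : u' (lift o i) o = 0.
    by rewrite mxE insert_conj_outr projE eq_sym (negPf (neq_lift _ _)) addr0.
  have u'oo : u' o o = 1 by rewrite mxE insert_conj_outr projE inE eqxx add0r.
  have Uu' : upper_unitriangular u'.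
    split=> [|i]; last by case: (unliftP o i) => [i'|] ->; rewrite ?u'lift ?du ?u'oo.
    apply/is_trig_mxP => i j; rewrite mxE.
    case: (unliftP o j) => [j'|] ->; case: (unliftP o i) => [i'|] ->;
      rewrite ?u'io ?u'oj ?ltnn //.
    by rewrite u'lift !lift_max => ij; move/is_trig_mxP: tu => /(_ _ _ ij); rewrite mxE.
  apply: (act u u'); first exact: upper_unitriangular_unit.
    exact: proj_out.
  by rewrite scale1r upv.
move=> t nzt; pose t' : 'rV[F]_N.+1 := \row_i oapp (t 0) 1 (unlift o i).
have nzt' i : t' 0 i != 0.
  by rewrite mxE; case: (unlift o i) => [j|] /=; rewrite ?nzt ?oner_eq0.
apply: (act _ (diag_mx t')); first exact: diag_mx_unit.
  apply: proj_out => [i j|j]; rewrite !mxE.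
    by rewrite (inj_eq lift_inj) liftK.
  by rewrite (negPf (neq_lift _ _)).
rewrite wtv // big_ord_recr /= mxE unlift_none nth_default // expr0 mulr1.
congr (_ *: _); apply: eq_bigr => i _; rewrite mxE.
have -> : widen_ord (leqnSn N) i = lift o i by apply: val_inj; rewrite /= /bump leqNgt ltn_ord.
by rewrite liftK.
Qed.

Lemma trunc_irr_poly : irr_poly_gl_rep lam trunc_rep.
Proof.
have [v hv] := trunc_hw; split; [exact: trunc_polynomial| |by exists v].
split; last exact: trunc_stable_full.
rewrite lt0n; apply/eqP => rk0; case: hv => /eqP nz_v _ _; apply: nz_v.
by apply/matrixP => i; have := ltn_ord i; rewrite [X in (_ < X)%N]rk0.
Qed.

End Truncation.

(** * Row and column stabilizers of a diagram with one more cell *)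

Lemma row_stabP N nu (s : 'S_N) :
  reflect (forall k : 'I_N, reshape_index nu (s k) = reshape_index nu k) (s \in row_stab N nu).
Proof. by rewrite inE; apply: (iffP forallP) => H k; apply/eqP; have := H k => // ->. Qed.

Lemma col_stabP N nu (s : 'S_N) :
  reflect (forall k : 'I_N, reshape_offset nu (s k) = reshape_offset nu k) (s \in col_stab N nu).
Proof. by rewrite inE; apply: (iffP forallP) => H k; apply/eqP; have := H k => // ->. Qed.

Lemma row_stabM N nu (s t : 'S_N) :
  s \in row_stab N nu -> t \in row_stab N nu -> (s * t)%g \in row_stab N nu.
Proof. by move=> /row_stabP Hs /row_stabP Ht; apply/row_stabP => k; rewrite permM Ht Hs. Qed.

Lemma col_stabM N nu (s t : 'S_N) :
  s \in col_stab N nu -> t \in col_stab N nu -> (s * t)%g \in col_stab N nu.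
Proof. by move=> /col_stabP Hs /col_stabP Ht; apply/col_stabP => k; rewrite permM Ht Hs. Qed.

Lemma row_stabV N nu (s : 'S_N) : s \in row_stab N nu -> (s^-1)%g \in row_stab N nu.
Proof. by move=> /row_stabP Hs; apply/row_stabP => k; rewrite -[in RHS](permKV s k) Hs. Qed.

Lemma col_stabV N nu (s : 'S_N) : s \in col_stab N nu -> (s^-1)%g \in col_stab N nu.
Proof. by move=> /col_stabP Hs; apply/col_stabP => k; rewrite -[in RHS](permKV s k) Hs. Qed.

Lemma tperm_row_stab N nu (i j : 'I_N) :
  reshape_index nu i = reshape_index nu j -> tperm i j \in row_stab N nu.
Proof. by move=> ij; apply/row_stabP => k; case: tpermP => [->|->|]. Qed.

Lemma tperm_col_stab N nu (i j : 'I_N) :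
  reshape_offset nu i = reshape_offset nu j -> tperm i j \in col_stab N nu.
Proof. by move=> ij; apply/col_stabP => k; case: tpermP => [->|->|]. Qed.

Lemma reshape_index_cons x s i :
  reshape_index (x :: s) i = if (i < x)%N then 0%N else (reshape_index s (i - x)).+1.
Proof.
rewrite /reshape_index /= subn_eq0; case: ltnP => // xi.
by rewrite subSn.
Qed.

Lemma reshape_offset_cons x s i :
  reshape_offset (x :: s) i = if (i < x)%N then i else reshape_offset s (i - x).
Proof.
rewrite /reshape_offset reshape_index_cons; case: ltnP => xi /=; first by rewrite subn0.
by rewrite subnDA.
Qed.

Lemma reshape_cell_inj nu i j :
  reshape_index nu i = reshape_index nu j -> reshape_offset nu i = reshape_offset nu j -> i = j.
Proof. by move=> rij cij; rewrite -(reshape_indexK nu i) rij cij reshape_indexK. Qed.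

(** * Cells before and after lengthening the first row *)

Section AddCell.

Variables (N : nat) (nu : seq nat) (z : 'I_N.+1).
Hypothesis nu_part : is_part_of N nu.
Hypothesis zE : z = head 0%N nu :> nat.
Let nu' := add_first_part 1 nu.

Lemma add_cell_cons : nu' = z.+1 :: behead nu.
Proof. by rewrite /nu' /add_first_part zE addn1. Qed.

Lemma part_cons : (0 < N)%N -> nu = (z : nat) :: behead nu.
Proof. by rewrite zE; case/andP: nu_part => _ /eqP <-; case: nu. Qed.

(** The new cell ends the first row, so its number is [head 0 nu] and every later cell moves up by
    one; this renumbering is [lift z]. *)
Lemma reshape_index_lift k : reshape_index nu' (lift z k) = reshape_index nu k.
Proof.
rewrite add_cell_cons [in RHS]part_cons ?(leq_ltn_trans _ (ltn_ord k)) //.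
rewrite !reshape_index_cons /= /bump.
case: (leqP z k) => zk; rewrite ?add1n ?add0n ?ltnS ?subSS.
  by rewrite ltnNge zk.
by rewrite (ltnW zk).
Qed.

Lemma reshape_offset_lift k : reshape_offset nu' (lift z k) = reshape_offset nu k.
Proof.
rewrite add_cell_cons [in RHS]part_cons ?(leq_ltn_trans _ (ltn_ord k)) //.
rewrite !reshape_offset_cons /= /bump.
case: (leqP z k) => zk; rewrite ?add1n ?add0n ?ltnS ?subSS.
  by rewrite ltnNge zk.
by rewrite (ltnW zk).
Qed.

Lemma reshape_index_new : reshape_index nu' z = 0%N.
Proof. by rewrite add_cell_cons reshape_index_cons ltnSn. Qed.

Lemma reshape_offset_new : reshape_offset nu' z = z.
Proof. by rewrite add_cell_cons reshape_offset_cons ltnSn. Qed.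

Lemma lift_row_stab s : (lift_perm z z s \in row_stab N.+1 nu') = (s \in row_stab N nu).
Proof.
apply/row_stabP/row_stabP => H k.
  by have := H (lift z k); rewrite lift_perm_lift !reshape_index_lift.
case: (unliftP z k) => [j|] ->; last by rewrite lift_perm_id.
by rewrite lift_perm_lift !reshape_index_lift.
Qed.

Lemma lift_col_stab s : (lift_perm z z s \in col_stab N.+1 nu') = (s \in col_stab N nu).
Proof.
apply/col_stabP/col_stabP => H k.
  by have := H (lift z k); rewrite lift_perm_lift !reshape_offset_lift.
case: (unliftP z k) => [j|] ->; last by rewrite lift_perm_id.
by rewrite lift_perm_lift !reshape_offset_lift.
Qed.

Lemma second_part : nth 0%N nu' 1 = nth 0%N nu 1.
Proof. by rewrite /nu' /add_first_part; case: nu. Qed.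

(** Every row below the first has at most [nth 0 nu 1] cells, and columns are counted from 0; so the
    columns from this number on consist of a single cell. *)
Lemma arm_row (k : 'I_N.+1) :
  (nth 0%N nu 1 <= reshape_offset nu' k)%N -> reshape_index nu' k = 0%N.
Proof.
move=> arm; apply/eqP; apply: contraLR arm; rewrite -lt0n -ltnNge => row_gt0.
have [/andP[srt _] /eqP sumE] := andP nu_part.
have k_lt : (k < sumn nu')%N.
  have -> : sumn nu' = N.+1; last exact: ltn_ord.
  by rewrite -sumE /nu' /add_first_part; case: nu => //= x s; rewrite addnAC addn1.
apply: leq_trans (reshape_offsetP k_lt) _; rewrite -second_part.
have srt' : sorted geq nu'.
  rewrite /nu' /add_first_part; case: (nu) srt => //= x [//|y s] /= /andP[xy ->].
  by rewrite andbT /geq /= (leq_trans xy) ?leq_addr.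
have := sorted_leq_nth (rev_trans leq_trans) leqnn 0%N srt'.
move=> /(_ 1%N (reshape_index nu' k)); rewrite !inE; apply => //.
  exact: leq_ltn_trans row_gt0 (reshape_indexP k_lt).
exact: reshape_indexP.
Qed.

Lemma arm_col_inj (k k' : 'I_N.+1) :
  (nth 0%N nu 1 <= reshape_offset nu' k)%N ->
  reshape_offset nu' k' = reshape_offset nu' k -> k' = k.
Proof.
move=> arm kk'; apply/val_inj/(reshape_cell_inj (nu := nu')) => //.
by rewrite !arm_row // kk'.
Qed.

Lemma second_le_new : (nth 0%N nu 1 <= z)%N.
Proof.
have [/andP[srt _] _] := andP nu_part.
by rewrite zE; case: (nu) srt => //= x [//|y s] /= /andP[].
Qed.

Lemma arm_col_stab (q : 'S_N.+1) (k : 'I_N.+1) :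
  (nth 0%N nu 1 <= reshape_offset nu' k)%N -> q \in col_stab N.+1 nu' -> q k = k.
Proof. by move=> arm /col_stabP qP; apply: arm_col_inj. Qed.

Lemma col_stab_new (q : 'S_N.+1) : q \in col_stab N.+1 nu' -> q z = z.
Proof. by apply: arm_col_stab; rewrite reshape_offset_new second_le_new. Qed.

(* Pigeonhole: S misses more cells than there are columns of length at least 2. *)
Lemma missing_cells (S : {set 'I_N.+1}) (d : nat) :
  (d <= N - nth 0%N nu 1)%N -> (#|S| <= d)%N ->
  (exists i j, [/\ i != j, i \notin S, j \notin S &
                   reshape_offset nu' i = reshape_offset nu' j]) \/
  (exists2 w, w \notin S & (nth 0%N nu 1 <= reshape_offset nu' w)%N).
Proof.
move=> dN Sd; set m2 := nth 0%N nu 1 in dN *.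
have [/existsP[w /andP[wS arm]]|noarm] :=
    boolP [exists w : 'I_N.+1, (w \notin S) && (m2 <= reshape_offset nu' w)%N].
  by right; exists w.
left.
have m2N : (m2 <= N)%N.
  by have := second_le_new; have := ltn_ord z; rewrite ltnS -/m2 => zN /leq_trans; apply.
have colP (i : 'I_N.+1) : i \notin S -> (reshape_offset nu' i < m2)%N.
  move=> iS; rewrite ltnNge; apply: contraNN noarm => arm.
  by apply/existsP; exists i; rewrite iS.
(* Otherwise the column number is injective on the missed cells, with values below [m2]. Then [S]
   and its complement have at most [(N - m2) + m2 = N] elements together, one too few. *)
apply: contrapT => noPair.
have inj : {in ~: S &, injective (fun i : 'I_N.+1 => reshape_offset nu' i)}.
  move=> i j; rewrite !inE => iS jS ij; apply/eqP; apply/negP => /negP nij.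
  by apply: noPair; exists i, j.
have : (#|~: S| <= m2)%N.
  rewrite cardE -(size_map (fun i : 'I_N.+1 => reshape_offset nu' i)).
  rewrite -[X in (_ <= X)%N](size_iota 0).
  apply: uniq_leq_size.
    by rewrite map_inj_in_uniq ?enum_uniq // => i j; rewrite !mem_enum; apply: inj.
  by move=> c /mapP[k]; rewrite mem_enum inE => /colP km2 ->; rewrite mem_iota.
move=> cS; have := cardsC S; rewrite card_ord => /eqP; apply/negP.
rewrite neq_ltn ltnS; apply/orP; left; apply: leq_trans (leq_add (leq_trans Sd dN) cS) _.
by rewrite subnK.
Qed.

Lemma fix_new_lift (p : 'S_N.+1) : p z = z -> exists s, p = lift_perm z z s.
Proof.
move=> pz.
have nz k : {j | p (lift z k) = lift z j}.
  case: (unliftP z (p (lift z k))) => [j ->|pk]; first by exists j.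
  by have := neq_lift z k; rewrite -(inj_eq (@perm_inj _ p)) pz pk eqxx.
pose g k := sval (nz k).
have gE k : p (lift z k) = lift z (g k) := svalP (nz k).
have injg : injective g.
  by move=> i j gij; apply: (@lift_inj _ z); apply: (@perm_inj _ p); rewrite !gE gij.
exists (perm injg); apply/permP => k.
case: (unliftP z k) => [j|] ->; last by rewrite lift_perm_id.
by rewrite lift_perm_lift permE gE.
Qed.

End AddCell.

(** * Adding a cell to the first row *)

Lemma permT_proj_eq (F : fieldType) N (s t : 'S_N) (T : {set 'I_N}) :
  {in T, s =1 t} -> permT s *m proj T = permT t *m proj T :> 'M[F]_N.
Proof.
move=> st; apply/matrixP=> i j; rewrite !mul_mx_diag [LHS]mxE [RHS]mxE !permTE !mxE.
by case jT: (j \in T); rewrite ?mulr0 // st.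
Qed.

Lemma row_symm_mulr (F : fieldType) N m nu (f : 'M[F]_N -> 'M[F]_m) (t : 'S_N) :
  (forall s t, f (permT s *m permT t) = f (permT s) *m f (permT t)) ->
  t \in row_stab N nu -> row_symm nu f *m f (permT t) = row_symm nu f.
Proof.
move=> fM tP; rewrite /row_symm mulmx_suml [RHS](reindex_inj (mulgI t)).
apply: eq_big => [s|s sP]; last by rewrite -fM -permTM.
apply/idP/idP => [sP|tsP]; first exact: row_stabM.
by rewrite -(mulKg t s) row_stabM ?row_stabV.
Qed.

Lemma row_symm_mull (F : fieldType) N m nu (f : 'M[F]_N -> 'M[F]_m) (t : 'S_N) :
  (forall s t, f (permT s *m permT t) = f (permT s) *m f (permT t)) ->
  t \in row_stab N nu -> f (permT t) *m row_symm nu f = row_symm nu f.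
Proof.
move=> fM tP; rewrite /row_symm mulmx_sumr [RHS](reindex_inj (mulIg t)).
apply: eq_big => [s|s sP]; last by rewrite -fM -permTM.
apply/idP/idP => [sP|tsP]; first exact: row_stabM.
by rewrite -(mulgK t s) row_stabM ?row_stabV.
Qed.

Lemma col_antisymm_mulr (F : fieldType) N m nu (f : 'M[F]_N -> 'M[F]_m) (t : 'S_N) :
  (forall s t, f (permT s *m permT t) = f (permT s) *m f (permT t)) ->
  t \in col_stab N nu ->
  col_antisymm nu f *m f (permT t) = (-1) ^+ odd_perm t *: col_antisymm nu f.
Proof.
move=> fM tP; rewrite /col_antisymm mulmx_suml scaler_sumr [RHS](reindex_inj (mulgI t)).
apply: eq_big => [s|s sP].
  apply/idP/idP => [sP|tsP]; first exact: col_stabM.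
  by rewrite -(mulKg t s) col_stabM ?col_stabV.
by rewrite odd_permM signr_addb scalerA mulrA -signr_addb addbb mul1r -scalemxAl -fM -permTM.
Qed.

Lemma row_stab_neq0 (F : numFieldType) N nu : (#|row_stab N nu|)%:R != 0 :> F.
Proof.
by rewrite pnatr_eq0 -lt0n; apply/card_gt0P; exists 1%g; apply/row_stabP => k; rewrite perm1.
Qed.

(** * Comparison of the two Young symmetrizers *)

Section Step.

Variables (F : numFieldType) (N m k d : nat) (sg : 'M[F]_N.+1 -> 'M[F]_m).
Hypothesis sgM : forall g h, sg (g *m h) = sg g *m sg h.
Hypothesis sg1 : sg 1%:M = 1%:M.
Variable X : {set 'I_N.+1} -> 'M[F]_m.
Hypothesis sgX : forall T, sg (proj T) = \sum_(S : {set 'I_N.+1} | S \subset T) X S.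
Hypothesis X_small : forall S : {set 'I_N.+1}, (d < #|S|)%N -> X S = 0.
Variables (nu : seq nat) (z : 'I_N.+1).
Hypothesis nu_part : is_part_of N nu.
Hypothesis zE : z = head 0%N nu :> nat.
Hypothesis d_le : (d <= N - nth 0%N nu 1)%N.
Variables (tau : gl_rep F N k) (C : 'M[F]_(m, k)) (R : 'M[F]_(k, m)).
Hypothesis CR : C *m R = sg (proj [set~ z]).
Hypothesis RC : R *m C = 1%:M.
Hypothesis tauC : forall g, C *m tau g = sg (insert F z *m g *m (insert F z)^T) *m C.

Let nu' := add_first_part 1 nu.
Let a := row_symm nu tau.
Let b := col_antisymm nu tau.
Let a' := row_symm nu' sg.
Let b' := col_antisymm nu' sg.

Let sg_permTM s t : sg (permT s *m permT t) = sg (permT s) *m sg (permT t).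
Proof. exact: sgM. Qed.

Let tau_permTM s t : tau (permT s *m permT t) = tau (permT s) *m tau (permT t).
Proof. by rewrite gl_funM ?permT_unit. Qed.

Let EC : sg (proj [set~ z]) *m C = C.
Proof. by rewrite -CR -mulmxA RC mulmx1. Qed.

Let sgC s : sg (permT (lift_perm z z s)) *m C = C *m tau (permT s).
Proof. by rewrite tauC -{1}EC mulmxA -sgM permT_lift_proj. Qed.

(** The new cell is alone in its column, so the larger column group is the lift of the smaller one,
    with the same signs. *)
Let colC : b' *m C = C *m b.
Proof.
rewrite /b' /b /col_antisymm mulmx_suml mulmx_sumr.
have injl : {in col_stab N nu &, injective (fun s : 'S_N => lift_perm z z s)}.
  move=> s t _ _ /permP st; apply/permP => i; have := st (lift z i).
  by rewrite !lift_perm_lift => /lift_inj.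
have -> : col_stab N.+1 nu' = [set lift_perm z z s | s in col_stab N nu].
  apply/setP => q; apply/idP/imsetP => [qQ|[s sQ ->]]; last by rewrite lift_col_stab.
  have [s qE] := fix_new_lift (col_stab_new nu_part zE qQ).
  by exists s => //; move: qQ; rewrite qE lift_col_stab.
rewrite big_imset //; apply: eq_bigr => s sQ.
by rewrite -scalemxAl sgC -scalemxAr odd_lift_perm addbb.
Qed.

(** Each lifted row permutation is absorbed by the larger row symmetrizer. *)
Let rowC : a' *m C *m a = #|row_stab N nu|%:R *: (a' *m C).
Proof.
rewrite [in LHS]/a /row_symm mulmx_sumr scaler_nat -sumr_const; apply: eq_bigr => s sP.
by rewrite -mulmxA -sgC mulmxA row_symm_mulr // lift_row_stab.
Qed.

Let X_off (S : {set 'I_N.+1}) : z \in S -> X S *m C = 0.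
Proof.
move=> zS; rewrite -EC mulmxA (support_part_right sgM sgX) ifF ?mul0mx //.
by apply/negbTE/negP => /subsetP/(_ z zS); rewrite !inE eqxx.
Qed.

(* Two cells of a column missing from the support kill a vector under the
   column antisymmetrizer; otherwise a one-cell column w is missing and the
   transposition (z w), which commutes with the column group, moves the
   support off z. *)
Let col_antisymm_support_part (S : {set 'I_N.+1}) :
  exists Y, a' *m b' *m X S = a' *m b' *m sg (proj [set~ z]) *m Y.
Proof.
have leX (T : {set 'I_N.+1}) : z \notin T -> sg (proj [set~ z]) *m X T = X T.
  move=> zT; rewrite (support_part_left sgM sgX) ifT //; apply/subsetP => i iT.
  by rewrite !inE; apply: contraNneq zT => <-.
have [dS|Sd] := ltnP d #|S|; first by exists 0; rewrite X_small // !mulmx0.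
have [[i [j [ij iS jS cij]]]|[w wS arm]] := missing_cells nu_part zE d_le Sd.
  exists 0; rewrite mulmx0 -mulmxA; suff -> : b' *m X S = 0 by rewrite mulmx0.
  (* The transposition of the missed cells [i] and [j] acts trivially on the image of [X S], but
     changes the sign of [b']. *)
  have : b' *m X S = - (b' *m X S).
    rewrite -{1}[X S](_ : sg (proj S) *m X S = X S); last first.
      by rewrite (support_part_left sgM sgX) subxx.
    rewrite -(@permT_proj_id _ _ (tperm i j)) => [|l lS]; last first.
      by rewrite tpermD //; apply: contraTneq lS => <-.
    rewrite sgM -mulmxA (support_part_left sgM sgX) subxx mulmxA.
    by rewrite col_antisymm_mulr ?tperm_col_stab // odd_tperm ij scaleN1r mulNmx.
  move/eqP; rewrite -addr_eq0 -mulr2n -scaler_nat scaler_eq0 pnatr_eq0 /=.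
  by move/eqP.
case: (boolP (z \in S)) => [zS|zS]; last by exists (X S); rewrite -[RHS]mulmxA leX.
pose t := tperm z w.
have tP : t \in row_stab N.+1 nu'.
  by apply: tperm_row_stab; rewrite (reshape_index_new zE) (arm_row nu_part arm).
have tC : sg (permT t) *m b' = b' *m sg (permT t).
  rewrite /b' /col_antisymm mulmx_sumr mulmx_suml; apply: eq_bigr => q qQ.
  rewrite -scalemxAr -scalemxAl -!sg_permTM -!permTM; congr (_ *: sg (permT _)).
  have qz := col_stab_new nu_part zE qQ; have qw := arm_col_stab nu_part arm qQ.
  have tq : (t ^ q)%g = t by rewrite /t tpermJ qz qw.
  by rewrite [RHS]conjgC tq.
(* Once moved past [b'], the transposition is absorbed by [a']. *)
have abt : a' *m b' = a' *m b' *m sg (permT t).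
  by rewrite -mulmxA -tC mulmxA row_symm_mulr.
exists (X (t @: S) *m sg (permT t)).
rewrite {1}abt -mulmxA (support_part_perm sgM sgX) -!mulmxA (mulmxA (sg _)) leX //.
by rewrite -[z](tpermR z w) (mem_imset _ _ (@perm_inj _ t)).
Qed.

(** A row permutation [p] contributes only if the preimage of [S] avoids [z], and then it acts on
    this preimage like a lifted row permutation, which [a] absorbs. So [c] counts these [p]; the
    identity is one of them. *)
Let row_symm_support_part (S : {set 'I_N.+1}) : z \notin S ->
  exists2 c : F, c != 0 & X S *m a' *m C *m a = c *: (X S *m C *m a).
Proof.
move=> zS; exists (#|[set p in row_stab N.+1 nu' | z \notin (p^-1)%g @: S]|%:R).
  rewrite pnatr_eq0 -lt0n; apply/card_gt0P; exists 1%g; rewrite inE; apply/andP; split.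
    by apply/row_stabP => l; rewrite perm1.
  rewrite invg1 (_ : _ @: S = S) //; rewrite -[RHS]imset_id.
  by apply: eq_imset => l; rewrite perm1.
rewrite scaler_nat -sumr_const (eq_bigl (fun p => (p \in row_stab N.+1 nu') &&
  (z \notin (p^-1)%g @: S))) => [|p]; last by rewrite inE.
have -> : X S *m a' *m C *m a =
    \sum_(p in row_stab N.+1 nu') X S *m sg (permT p) *m C *m a.
  by rewrite -!mulmx_suml -mulmx_sumr.
rewrite big_mkcondr /=; apply: eq_bigr => p pP.
set T := (p^-1)%g @: S.
have pT : p @: T = S.
  by rewrite -imset_comp -[RHS]imset_id; apply: eq_imset => l; rewrite /= permKV.
rewrite -pT -(support_part_perm sgM sgX); case: ifP => [zT|/negbFE zT]; last first.
  by rewrite -(mulmxA (sg _)) X_off // mulmx0 mul0mx.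
have [h hP hT] : exists2 h, h \in row_stab N nu & {in T, p =1 lift_perm z z h}.
  (* Correcting [p] by a transposition inside the first row makes it fix [z]. Nothing changes on
     [T], since [z] lies neither in [T] nor in its image [S]. *)
  pose q := if p z == z then p else (p * tperm (p z) z)%g.
  have qP : q \in row_stab N.+1 nu'.
    rewrite /q; case: ifP => // _; apply: row_stabM => //; apply: tperm_row_stab.
    by move/row_stabP: pP => ->.
  have qz : q z = z by rewrite /q; case: eqP => // _; rewrite permM tpermL.
  have qT : {in T, p =1 q}.
    move=> l lT; rewrite /q; case: eqP => // _; rewrite permM tpermD //.
      by rewrite (inj_eq perm_inj); apply: contraNneq zT => ->.
    by apply: contraNneq zS => ->; rewrite -pT; apply: imset_f.
  have [h qE] := fix_new_lift qz.
  by exists h; [move: qP; rewrite qE lift_row_stab | rewrite -qE].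
have XT : X T = sg (proj T) *m X T by rewrite (support_part_left sgM sgX) subxx.
rewrite XT mulmxA -sgM (permT_proj_eq _ hT) sgM -(mulmxA (sg _)) -XT.
rewrite (support_part_perm sgM sgX) -!mulmxA (mulmxA (sg _)) sgC -mulmxA row_symm_mull //.
by congr (X _ *m _); apply: eq_in_imset => l lT; rewrite hT.
Qed.

(** Everything passes through [a' *m b' *m C], which is a nonzero multiple of [a' *m C *m (a *m b)].
    Inverting the counts of [row_symm_support_part] on each component recovers [a *m b] from it;
    conversely [a' *m b'] factors through it by [col_antisymm_support_part]. *)
Lemma rank_step : \rank (a *m b) = \rank (a' *m b').
Proof.
have nzP := @row_stab_neq0 F N nu.
have abC : a' *m b' *m C = #|row_stab N nu|%:R^-1 *: (a' *m C *m (a *m b)).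
  by rewrite mulmxA rowC -scalemxAl scalerA mulVf // scale1r -mulmxA colC mulmxA.
apply/eqP; rewrite eqn_leq; apply/andP; split.
  (* For [z \in S] both sides vanish, so any coefficient will do. *)
  have cP S : exists c : F, X S *m C *m a = c *: (X S *m a' *m C *m a).
    case: (boolP (z \in S)) => zS; first by exists 0; rewrite X_off // mul0mx scale0r.
    have [c nz_c cE] := row_symm_support_part zS; exists c^-1.
    by rewrite cE scalerA mulVf // scale1r.
  have [c cE] := choice cP.
  have -> : a *m b = R *m (\sum_S c S *: X S) *m (#|row_stab N nu|%:R *: (a' *m b' *m C)).
    rewrite abC scalerA mulfV // scale1r -[a in LHS]mul1mx -RC -!mulmxA; congr (R *m _).
    rewrite !mulmxA; congr (_ *m b).
    rewrite -[C in LHS]mul1mx -sg1 (sum_support_part sgX) !mulmx_suml; apply: eq_bigr => S _.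
    by rewrite cE -!scalemxAl.
  apply: leq_trans (mxrankM_maxr _ _) _; rewrite scalemxAl.
  apply: leq_trans (mxrankM_maxl _ _) _; rewrite mxrank_scale_nz //.
have [Y YE] := choice col_antisymm_support_part.
have -> : a' *m b' = a' *m b' *m sg (proj [set~ z]) *m \sum_S Y S.
  rewrite -{1}[a' *m b']mulmx1 -sg1 (sum_support_part sgX) [LHS]mulmx_sumr [RHS]mulmx_sumr.
  apply: eq_bigr => S _.
  exact: YE.
rewrite -CR mulmxA abC; apply: leq_trans (mxrankM_maxl _ _) _.
apply: leq_trans (mxrankM_maxl _ _) _; rewrite mxrank_scale_nz ?invr_eq0 //.
exact: mxrankM_maxr.
Qed.

End Step.

(** * Stability *)

Lemma dim_Hom_specht_unique (F : numFieldType) N m k nu lam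
    (rho : gl_rep F N m) (tau : gl_rep F N k) :
  irr_poly_gl_rep lam rho -> irr_poly_gl_rep lam tau ->
  \dim (Hom_repr (specht F N nu) (perm_restr rho)) =
  \dim (Hom_repr (specht F N nu) (perm_restr tau)).
Proof.
move=> irr irt; rewrite !dim_Hom_specht.
have [A [B [AB BA ABrho]]] := hw_rep_unique irr irt.
have tauE g : g \in unitmx -> tau g = A *m rho g *m B.
  by move=> Ug; rewrite ABrho // -mulmxA AB mulmx1.
have rowE : row_symm nu tau = A *m row_symm nu rho *m B.
  rewrite /row_symm mulmx_sumr mulmx_suml; apply: eq_bigr => s _.
  by rewrite tauE ?permT_unit.
have colE : col_antisymm nu tau = A *m col_antisymm nu rho *m B.
  rewrite /col_antisymm mulmx_sumr mulmx_suml; apply: eq_bigr => s _.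
  by rewrite tauE ?permT_unit // -scalemxAr -scalemxAl.
set a := row_symm nu rho in rowE *; set b := col_antisymm nu rho in colE *.
have -> : row_symm nu tau *m col_antisymm nu tau = A *m (a *m b) *m B.
  by rewrite rowE colE !mulmxA -(mulmxA _ B A) BA mulmx1.
apply/eqP; rewrite eqn_leq; apply/andP; split; last first.
  by apply: leq_trans (mxrankM_maxl _ _) _; apply: mxrankM_maxr.
have {1}-> : a *m b = B *m (A *m (a *m b) *m B) *m A.
  by rewrite !mulmxA BA mul1mx -!mulmxA BA mulmx1.
by apply: leq_trans (mxrankM_maxl _ _) _; apply: mxrankM_maxr.
Qed.

Lemma part_size_le lam : is_part lam -> (size lam <= sumn lam)%N.
Proof.
case/andP=> _; elim: lam => //= x s IHs; rewrite inE negb_or eq_sym -lt0n => /andP[x0 s0].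
by rewrite -add1n leq_add ?IHs.
Qed.

(** [tau] is the truncation of [rho] at the number of the new cell, written in the bases from the
    rank factorization of the idempotent [E]. *)
Lemma dim_Hom_specht_step (F : numFieldType) N m nu lam (rho : gl_rep F N.+1 m) :
  is_part_of N nu -> is_part lam -> (sumn lam <= N - nth 0%N nu 1)%N ->
  irr_poly_gl_rep lam rho ->
  exists k (tau : gl_rep F N k), irr_poly_gl_rep lam tau /\
    \dim (Hom_repr (specht F N nu) (perm_restr tau)) =
    \dim (Hom_repr (specht F N.+1 (add_first_part 1 nu)) (perm_restr rho)).
Proof.
move=> nu_part lam_part lamN irr.
have sz_lam : (size lam <= N)%N.
  exact: leq_trans (part_size_le lam_part) (leq_trans lamN (leq_subr _ _)).
have [pol _ _] := irr.
have [sg [sg_rho sgM sgP]] := gl_polynomial_ext pol.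
have sg1 : sg 1%:M = 1%:M by rewrite sg_rho ?unitmx1 // gl_fun1.
have sgZ x : x != 0 -> sg x%:M = (x ^+ sumn lam)%:M.
  move=> nz_x; rewrite sg_rho; last by rewrite unitmxE unitfE det_scalar expf_neq0.
  exact: (hw_scalar irr (leqW sz_lam) nz_x).
have [X [sgX X_small]] := support_decomp sgM sgP sgZ.
have head_lt : (head 0%N nu < N.+1)%N.
  by case/andP: nu_part => _ /eqP <-; rewrite ltnS; case: (nu) => [|x s] //=; apply: leq_addr.
pose z := Ordinal head_lt; pose E := sg (proj [set~ z]).
have EE : E *m E = E by rewrite -sgM projM setIid.
have CR : col_base E *m row_base E = E := mulmx_base E.
have RC := idempotent_factor EE.
exists (\rank E), (trunc_rep sgM CR RC); split.
  exact: trunc_irr_poly irr sz_lam _ sg_rho sgM sgP _ _ _ _ CR RC.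
rewrite !dim_Hom_specht (rank_step sgM sg1 sgX X_small nu_part (z := z) _ lamN CR RC) //;
  last first.
  exact: trunc_col.
congr (\rank (_ *m _)); apply: eq_bigr => s _; by rewrite sg_rho ?permT_unit.
Qed.

Lemma add_first_partD r mu : add_first_part 1 (add_first_part r mu) = add_first_part r.+1 mu.
Proof. by rewrite /add_first_part /= -addnA addn1. Qed.

Lemma add_first_part_part_of r n mu : (0 < n)%N -> is_part_of n mu ->
  is_part_of (n + r) (add_first_part r mu).
Proof.
move=> n_gt0 /andP[/andP[srt pos] /eqP sumE]; apply/andP; split; last first.
  by move: n_gt0; rewrite -sumE; case: (mu) => //= x s _; rewrite addnAC.
case: mu srt pos sumE n_gt0 => [|x s] /=; first by move=> _ _ <-.
move=> srt pos _ _; apply/andP; split.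
  by case: s srt {pos} => //= y s /andP[yx ->]; rewrite andbT /geq /= (leq_trans yx) ?leq_addr.
move: pos; rewrite /add_first_part /= !inE !negb_or ![0%N == _]eq_sym -!lt0n => /andP[x0 ->].
by rewrite addn_gt0 x0.
Qed.

(** Induction that removes one cell at a time from the larger diagram, ending with uniqueness of the
    representation for [r = 0]. The size is a separate variable [N] so that the type of [G] has the
    form required by the one-cell step. The bound survives, as adding cells to the first row keeps
    the second part. *)
Lemma dim_Hom_specht_stable (K : numFieldType) (n : nat) (mu lam : seq nat) (m : nat)
    (F : gl_rep K n m) :
  (0 < n)%N -> is_part_of n mu -> is_part lam -> (sumn lam <= n - nth 0%N mu 1)%N ->
  irr_poly_gl_rep lam F ->
  forall N r, N = (n + r)%N -> forall k (G : gl_rep K N k), irr_poly_gl_rep lam G ->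
  \dim (Hom_repr (specht K n mu) (perm_restr F)) =
  \dim (Hom_repr (specht K N (add_first_part r mu)) (perm_restr G)).
Proof.
move=> hn hmu hlam hle hF; elim=> [|N IHN] [|s] NE k G irrG.
- by exfalso; move: NE hn; rewrite addn0 => <-.
- by move: NE; rewrite addnS.
- have mu_cons : add_first_part 0 mu = mu.
    case/andP: hmu => _ /eqP sumE; case: (mu) sumE hn => [<-|x s] //.
    by rewrite /add_first_part /= addn0.
  move: G irrG; rewrite NE addn0 mu_cons => G irrG.
  exact: dim_Hom_specht_unique hF irrG.
have {}NE : N = (n + s)%N by apply: succn_inj; rewrite NE addnS.
have nu_part : is_part_of N (add_first_part s mu).
  by rewrite NE add_first_part_part_of.
have lamN : (sumn lam <= N - nth 0%N (add_first_part s mu) 1)%N.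
  apply: leq_trans hle _; rewrite NE /add_first_part /= nth_behead.
  by rewrite leq_sub2r ?leq_addr.
have [j [tau [irr_tau tauE]]] := dim_Hom_specht_step nu_part hlam lamN irrG.
rewrite -add_first_partD -tauE; exact: IHN.
Qed.

Theorem corollary10 (R : realType) (n r : nat) (mu lam : seq nat)
    (hn : (0 < n)%N)
    (hmu : is_part_of n mu)
    (hlam : is_part lam)
    (hle : (sumn lam <= n - nth 0%N mu 1)%N)
    (m m' : nat)
    (F : gl_rep R[i] n m) (F' : gl_rep R[i] (n + r) m')
    (hF : irr_poly_gl_rep lam F)
    (hF' : irr_poly_gl_rep lam F') :
  \dim (Hom_repr (specht R[i] n mu) (perm_restr F)) =
  \dim (Hom_repr (specht R[i] (n + r) (add_first_part r mu)) (perm_restr F')).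
Proof.
exact: (@dim_Hom_specht_stable R[i] n mu lam m F hn hmu hlam hle hF _ r erefl m' F' hF').
Qed.
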